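(* Let $T$ be a complete NIP $L$-theory, $M \models T$, and let $G$ be an $M$-definable group. Let $T' := \mathrm{Th}_{L'}(M^{\mathrm{Sh}})$ and let $\widetilde{M}' \succ^{L'} M^{\mathrm{Sh}}$ be a monster model of $T'$ with underlying $L$-structure $M'$. (a) If $H'$ is an externally definable subgroup of $G(M)$ which is fsg in $T'$, then $H'$ is already an $L(M)$-definable subgroup of $G$ in $T$. (b) If $H'$ is a subgroup of $G(M')$ which is type-definable over $M$ in $T'$ and which is fsg in $T'$ (as a type-definable group), then $H'(M')$ is $L(M)$-type-definable in $T$, defined by a partial $L(M)$-type of size at most $|T|$.
   Context: Shelah expansion. Let $M \models T$ and fix an $|M|^+$-saturated $N \succeq M$. A subset of $M^n$ is externally definable if it is of the form $\varphi(M,d)=\{a \in M^n : N \models \varphi(a,d)\}$ for some $\varphi(x,y)\in L$ and $d$ in $N$. $M^{\mathrm{Sh}}$ is the expansion of $M$ in the language $L'$ which has a relation symbol $R_{\varphi(x,d)}$, interpreted as $\varphi(M,d)$, for every $\varphi(x,y)\in L$ and $d$ in $N$ (for $\varphi(x) \in L$ one identifies $R_{\varphi(x)}$ with $\varphi$; in particular every element of $M$ is named). Monster model: let $(N,M)$ be the pair in the language $L_P=L\cup\{P\}$ with $P$ naming $M$, and let $(N',M')\succ^{L_P}(N,M)$ be a sufficiently (at least $|N|^+$-) saturated extension; $\widetilde{M}'$ is the $L'$-structure on $M'$ in which $R_{\varphi(x,d)}$ is interpreted as $\varphi(M',d)$ (computed in $N'$). Then $\widetilde M' \succ^{L'} M^{\mathrm{Sh}}$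 is a saturated model of $T'$, regarded as a monster model of $T'$, and its $L$-reduct $M'$ is regarded as a monster model of $T$. fsg. In a theory with monster model $\mathbb{M}$, a type-definable (in particular, definable) group $G$ is fsg if there are a global type $p\in S_G(\mathbb{M})$ (i.e. a complete type over $\mathbb M$ concentrating on $G$) and a small model $M_0\prec\mathbb{M}$ such that $G$ is type-definable over $M_0$ and for every $g\in G(\mathbb{M})$ the translate $g\cdot p$ is finitely satisfiable in $G(M_0)$. An externally definable subgroup $H'$ of $G(M)$, being defined in $M^{\mathrm{Sh}}$ by an $L'(M)$-formula, is called fsg in $T'$ if the group defined by that formula in $\widetilde{M}'$ is fsg. *)

(* Defs.v *)
From mathcomp Require Import all_boot all_classical.

Set Implicit Arguments.
Unset Strict Implicit.
Unset Printing Implicit Defensive.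

Local Open Scope classical_set_scope.
Local Open Scope card_scope.

(** * First-order logic (one-sorted) *)

Record language := Language {
  fsym : Type;
  rsym : Type;
  farity : fsym -> nat;
  rarity : rsym -> nat
}.

Inductive term (L : language) (V : Type) : Type :=
| Var of V
| App (f : fsym L) of ('I_(farity f) -> term L V).

(* Free variables are indexed by an arbitrary type [V]; [All] binds the
   variable [None].  A formula in the variables [V] with parameters from [A]
   is a [formula L (V + A)], see [glue] below. *)
Inductive formula (L : language) (V : Type) : Type :=
| Bot
| Eq of term L V & term L V
| Rel (r : rsym L) of ('I_(rarity r) -> term L V)
| Imp of formula L V & formula L V
| All of formula L (option V).

Arguments Bot {L V}.

Definition Not (L : language) (V : Type) (phi : formula L V) := Imp phi Bot.

Notation sentence L := (formula L void).

Record structure (L : language) := Structure {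
  carrier :> Type;
  carrier_inhabited : inhabited carrier;
  finterp : forall f : fsym L, ('I_(farity f) -> carrier) -> carrier;
  rinterp : forall r : rsym L, ('I_(rarity r) -> carrier) -> Prop
}.

Section Semantics.
Variables (L : language) (S : structure L).

Fixpoint eval (V : Type) (v : V -> S) (t : term L V) : S :=
  match t with
  | Var x => v x
  | App f ts => finterp (fun k => eval v (ts k))
  end.

Fixpoint sat (V : Type) (phi : formula L V) : (V -> S) -> Prop :=
  match phi with
  | Bot => fun=> False
  | Eq s t => fun v => eval v s = eval v t
  | Rel r ts => fun v => rinterp (fun k => eval v (ts k))
  | Imp phi psi => fun v => sat phi v -> sat psi v
  | All phi => fun v =>
      forall a : S, sat phi (fun o => if o is Some x then v x else a)
  end.

End Semantics.

Definition glue (V A S : Type) (x : V -> S) (f : A -> S) (u : V + A) : S :=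
  match u with inl k => x k | inr a => f a end.

(** In the rest of the file a parameter set is given as a family
    [f : A -> S]; for instance [f] is an embedding of a smaller model. *)
Section Definability.
Variables (L : language) (S : structure L) (V A : Type) (f : A -> S).

Definition defset (phi : formula L (V + A)) : set (V -> S) :=
  [set x | sat phi (glue x f)].

Definition tdefset (pi : set (formula L (V + A))) : set (V -> S) :=
  [set x | forall phi, pi phi -> defset phi x].

Definition definable (X : set (V -> S)) := exists phi, X = defset phi.

Definition type_definable (X : set (V -> S)) := exists pi, X = tdefset pi.

Definition finitely_satisfiable_in (pi : set (formula L (V + A)))
    (B : set (V -> S)) :=
  forall F, finite_set F -> F `<=` pi -> exists2 x, B x & tdefset F x.

End Definability.

Arguments defset {L} S {V A} f phi.
Arguments tdefset {L} S {V A} f pi.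
Arguments definable {L} S {V A} f X.
Arguments type_definable {L} S {V A} f X.
Arguments finitely_satisfiable_in {L} S {V A} f pi B.

Definition models (L : language) (S : structure L) (T : set (sentence L)) :=
  forall sigma, T sigma -> forall v : void -> S, sat sigma v.

Definition entails (L : language) (T : set (sentence L)) (sigma : sentence L) :=
  forall S : structure L, models S T -> forall v : void -> S, sat sigma v.

Definition complete_theory (L : language) (T : set (sentence L)) :=
  (exists S : structure L, models S T) /\
  forall sigma, entails T sigma \/ entails T (Not sigma).

(* Every formula phi(x, y) has finite VC-dimension, uniformly in the models
   of [T]. *)
Definition NIP (L : language) (T : set (sentence L)) :=
  forall (m l : nat) (phi : formula L ('I_m + 'I_l)),
  exists k : nat, forall S : structure L, models S T ->
  ~ exists (a : 'I_k -> 'I_m -> S) (b : {set 'I_k} -> 'I_l -> S),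
      forall i (J : {set 'I_k}), sat phi (glue (a i) (b J)) <-> i \in J.

Record embedding (L : language) (S1 S2 : structure L) (h : S1 -> S2) : Prop :=
  Embedding {
    embedding_inj : injective h;
    embedding_fun : forall (f : fsym L) (x : 'I_(farity f) -> S1),
      h (finterp x) = finterp (h \o x);
    embedding_rel : forall (r : rsym L) (x : 'I_(rarity r) -> S1),
      rinterp x <-> rinterp (h \o x)
  }.

Definition elementary (L : language) (S1 S2 : structure L) (h : S1 -> S2) :=
  forall (V : Type) (phi : formula L V) (v : V -> S1),
    sat phi v <-> sat phi (h \o v).

(* [S] is kappa^+-saturated, where kappa is the cardinality of [K]. *)
Definition succ_saturated (K : Type) (L : language) (S : structure L) :=
  forall (A : Type) (f : A -> S), range f #<= [set: K] ->
  forall (n : nat) (pi : set (formula L ('I_n + A))),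
    finitely_satisfiable_in S f pi setT -> tdefset S f pi !=set0.

Arguments elementary {L} S1 S2 h.
Arguments succ_saturated K {L} S.

(** * Pairs and the Shelah expansion *)

(* The language L_P; [None] is the predicate P. *)
Definition pair_lang (L : language) : language :=
  {| fsym := fsym L;
     rsym := option (rsym L);
     farity := @farity L;
     rarity := fun o => if o is Some r then rarity r else 1%N |}.

Definition pair_struct (L : language) (M N : structure L) (i : M -> N) :
    structure (pair_lang L) :=
  @Structure (pair_lang L) N (carrier_inhabited N)
    (fun f => @finterp L N f)
    (fun o => match o return ('I_(@rarity (pair_lang L) o) -> N) -> Prop with
      | Some r => @rinterp L N r
      | None => fun x => range i (x ord0)
      end).

Definition externally_definable (L : language) (M N : structure L) (i : M -> N)
    (V : Type) (X : set (V -> M)) :=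
  exists phi : formula L (V + N), X = [set x | sat phi (glue (i \o x) idfun)].

(* The language L': besides the symbols of L it has a relation symbol
   R_{phi(x,d)} for each formula phi(x,d) with parameters d from [D].  Keeping
   the symbols of L makes M^Sh a literal expansion of M; in T' they are
   interchangeable with the corresponding R_phi. *)
Definition shelah_lang (L : language) (D : Type) : language :=
  {| fsym := fsym L;
     rsym := (rsym L + {n : nat & formula L ('I_n + D)})%type;
     farity := @farity L;
     rarity := fun s => match s with inl r => rarity r | inr R => projT1 R end |}.

(* The L'-structure on [M] in which R_{phi(x,d)} is phi(M, e d), computed in
   [N].  With [e := idfun] this is M^Sh; with an extension (N', M') of the pair
   and [e] the inclusion of N in N' it is the monster model of Th(M^Sh). *)
Definition shelah_struct (L : language) (D : Type) (M N : structure L)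
    (i : M -> N) (e : D -> N) : structure (shelah_lang L D) :=
  @Structure (shelah_lang L D) M (carrier_inhabited M)
    (fun f => @finterp L M f)
    (fun s =>
      match s return ('I_(@rarity (shelah_lang L D) s) -> M) -> Prop with
      | inl r => @rinterp L M r
      | inr R => fun x => sat (projT2 R) (glue (i \o x) e)
      end).

(** * Definable groups and fsg *)

(* [mul x y z] stands for x * y = z, and only matters on [G]. *)
Definition is_group (X : Type) (G : set X) (mul : X -> X -> X -> Prop) :=
  [/\ forall x y, G x -> G y -> exists! z, G z /\ mul x y z,
      forall x y z xy yz xyz, G x -> G y -> G z -> G xy -> G yz -> G xyz ->
        mul x y xy -> mul y z yz -> mul xy z xyz -> mul x yz xyz &
      exists2 e, G e & forall x, G x ->
        [/\ mul e x x, mul x e x &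
            exists2 y, G y & mul x y e /\ mul y x e]].

Definition subgroup (X : Type) (G : set X) (mul : X -> X -> X -> Prop)
    (H : set X) :=
  H `<=` G /\ is_group H mul.

Definition triple (V S : Type) (x y z : V -> S) : V + V + V -> S :=
  glue (glue x y) z.

Definition defmul (L : language) (S : structure L) (V A : Type) (f : A -> S)
    (mu : formula L (V + V + V + A)) (x y z : V -> S) : Prop :=
  defset S f mu (triple x y z).

Arguments defmul {L} S {V A} f mu x y z.

Definition type_definable_group (L : language) (S : structure L) (V A : Type)
    (f : A -> S) (G : set (V -> S))
    (mul : (V -> S) -> (V -> S) -> (V -> S) -> Prop) :=
  [/\ is_group G mul, type_definable S f G &
      type_definable S f
        [set w | exists x y z,
          w = triple x y z /\ [/\ G x, G y, G z & mul x y z]]].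

Section GlobalTypes.
Variables (L : language) (U : structure L) (V : Type).

Definition global_type (p : set (formula L (V + U))) :=
  finitely_satisfiable_in U idfun p setT /\ forall phi, p phi \/ p (Not phi).

(* If [G] is defined by a partial type pi over a small set and [U] is
   saturated, this says that p implies pi. *)
Definition concentrates_on (p : set (formula L (V + U))) (G : set (V -> U)) :=
  forall phi, G `<=` defset U idfun phi -> p phi.

(* phi(x) is in g p iff phi(g x) is in p; here psi(x) plays the role of
   phi(g x), and is determined modulo p by its trace on [G] when p
   concentrates on [G]. *)
Definition translate (G : set (V -> U))
    (mul : (V -> U) -> (V -> U) -> (V -> U) -> Prop) (g : V -> U)
    (p : set (formula L (V + U))) : set (formula L (V + U)) :=
  [set phi | exists2 psi, p psi &
    forall x gx, G x -> G gx -> mul g x gx ->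
      (defset U idfun psi x <-> defset U idfun phi gx)].

End GlobalTypes.

(* The group [G] is fsg, in a monster model [U] where a set is small when its
   cardinality is at most that of [K]. *)
Definition fsg (K : Type) (L : language) (U : structure L) (V : Type)
    (G : set (V -> U)) (mul : (V -> U) -> (V -> U) -> (V -> U) -> Prop) :=
  exists (p : set (formula L (V + U))) (M0 : structure L) (f : M0 -> U),
    [/\ global_type p /\ concentrates_on p G,
        elementary M0 U f,
        [set: M0] #<= [set: K],
        type_definable_group f G mul &
        forall g, G g ->
          finitely_satisfiable_in U idfun (translate G mul g p)
            (G `&` [set x | exists a : V -> M0, x = f \o a])].

Arguments fsg K {L} U {V} G mul.

(* Main.v *)
From mathcomp Require Import all_boot all_classical.
Require Import Defs.

Set Implicit Arguments.
Unset Strict Implicit.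
Unset Printing Implicit Defensive.

Local Open Scope classical_set_scope.
Local Open Scope card_scope.

(** Write U for the structure induced on M' by the traces of the formulas over
    N, and G for the group in U. Part (a) follows from part (b): a set that is
    definable in U over M and is an intersection of L(M)-definable sets equals,
    by compactness, one L(M)-definable set, whose formula then defines the
    given subgroup in M ([fsg_definable]).

    For (b), let H be an fsg subgroup, p the type and M0 the small model that
    witness this, and H(M0) the set of points of H with coordinates in M0. If
    a definable set psi contains H(M0), then psi belongs to every translate of
    p by an element of H, since these are finitely satisfiable in H(M0). As p
    itself is finitely satisfiable in H(M0), every g in H has an m in H(M0)
    with g m in psi ([fsg_translates]), that is, H is contained in the union
    of the sets psi m^-1.

    Let H be contained in chi0, a formula over M in the expanded language. By
    compactness there is chi containing H such that g lies in chi0 as soon as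
    h and g h lie in chi ([over_cancel]). If some L(M')-formula psi satisfies
    H(M0) <= psi <= chi, the previous paragraph yields finitely many m in
    H(M0) such that the union of the psi m^-1 lies between H and chi0. This
    union is L(M')-definable; its parameters can be moved to M, because M^Sh
    is an elementary substructure of U ([definable_interpolant]). Hence H is an
    intersection of L(M)-definable sets. Moreover compactness provides, for
    each L-formula phi(x, y), finitely many m and one set containing H that
    work for all instances phi(x, b) at once ([uniform_translates]), so that
    one L(M)-formula for each phi is enough ([type_definable_small]).

    The psi above is an honest definition of chi over M0. When chi is given by
    a formula phi(x, d) with d in N, it comes from NIP
    ([honest_definition]): if no psi <= phi(M', d) covers the points of
    phi(x, d) in a small set A, there is an ultrafilter on A concentrating on
    these points and avoiding every such psi. Its Morley sequences in M' can
    then be built with an arbitrary pattern of truth values of phi(x, d); but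
    they all have the same L-type, so that a single one is shattered by the
    instances of phi. Every formula of the expanded language is of the form
    phi(x, d) ([quantifier_elimination]), because the projection of a set with
    an honest definition over M is again externally definable
    ([projection]). *)


(** * Cardinal arithmetic *)

Lemma infinite_inj_nat (T : Type) (A : set T) :
  infinite_set A -> exists2 g : nat -> T, injective g & forall n, A (g n).
Proof.
elim/Ppointed: T => T in A *.
  by move=> /infinite_setN0[x]; have := no x.
move=> /infiniteP/pcard_leP[g]; exists g => [m n|n]; last exact: funS.
by apply: inj; rewrite inE.
Qed.

Lemma inj_add_nat (K : Type) : infinite_set [set: K] ->
  exists f : K + nat -> K, injective f.
Proof.
move=> /infinite_inj_nat[g g_inj _].
pose f u := match u with
  | inl x => if pselect (exists n, x = g n) is left ex then g (sval (cid ex)).*2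
             else x
  | inr n => g n.*2.+1
  end.
have fr n : f (inl (g n)) = g n.*2.
  rewrite /f; case: pselect => [ex|[]]; last by exists n.
  by case: cid => m /= /g_inj ->.
have fn x : ~ (exists n, x = g n) -> f (inl x) = x.
  by rewrite /f; case: pselect.
have neq m n : g m.*2 <> g n.*2.+1.
  by move=> /g_inj /(congr1 odd); rewrite /= !odd_double.
exists f => -[x|m] [y|n].
- have [[k ->]|xg] := pselect (exists n, x = g n);
    have [[l ->]|yg] := pselect (exists n, y = g n).
  + by rewrite !fr => /g_inj/double_inj ->.
  + by rewrite fr fn// => yE; case: yg; exists k.*2.
  + by rewrite fr fn// => xE; case: xg; exists l.*2.
  + by rewrite !fn// => ->.
- have [[k ->]|xg] := pselect (exists n, x = g n).
    by rewrite fr => /neq.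
  by rewrite fn// => xE; case: xg; exists n.*2.+1.
- have [[k ->]|yg] := pselect (exists n, y = g n).
    by rewrite fr => /esym/neq.
  by rewrite fn// => yE; case: yg; exists m.*2.+1.
- by move=> /g_inj [/double_inj ->].
Qed.

Lemma bit_double_inj (b c : bool) m n :
  (b + m.*2 = c + n.*2)%N -> b = c /\ m = n.
Proof.
move=> E; split; last first.
  by have := congr1 half E; rewrite !half_bit_double.
have := congr1 odd E; rewrite !oddD !odd_double !addbF.
by case: (b) (c) => -[].
Qed.

(** Zorn's lemma gives a maximal bijection between [D * bool] and a subset of
    [D], for [D] a subset of [K]. Then [D] is cofinite, as otherwise a
    copy of [nat * bool] could be added, and the finite remainder is absorbed
    by [inj_add_nat]. *)
Lemma inj_mul_bool (K : Type) : infinite_set [set: K] ->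
  exists f : K * bool -> K, injective f.
Proof.
move=> Kinf.
pose P (R : set ((K * bool) * K)) := [/\
  forall p y y', R (p, y) -> R (p, y') -> y = y',
  forall p p' y, R (p, y) -> R (p', y) -> p = p',
  forall x b c y, R ((x, b), y) -> exists z, R ((x, c), z) &
  forall x b y, R ((x, b), y) -> exists z, R ((y, true), z)].
have [F FP Ftot|R [[Rf Ri Rb Rd] Rmax]] := @Zorn_bigcup _ P.
  have tot2 u v : (\bigcup_(X in F) X) u -> (\bigcup_(X in F) X) v ->
      exists2 X, F X & X u /\ X v.
    move=> [X FX Xu] [Y FY Yv]; have [XY|YX] := Ftot _ _ FX FY.
      by exists Y => //; split=> //; apply: XY.
    by exists X => //; split=> //; apply: YX.
  split.
  - move=> p y y' Ry Ry'; have [X /FP[Xf _ _ _] [Xy Xy']] := tot2 _ _ Ry Ry'.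
    exact: Xf Xy Xy'.
  - move=> p p' y Rp Rp'; have [X /FP[_ Xi _ _] [Xp Xp']] := tot2 _ _ Rp Rp'.
    exact: Xi Xp Xp'.
  - move=> x b c y [X FX]; have [_ _ Xb _] := FP _ FX => /(Xb _ _ c)[z Xz].
    by exists z, X.
  - move=> x b y [X FX]; have [_ _ _ Xd] := FP _ FX => /Xd[z Xz].
    by exists z, X.
pose D : set K := [set x | exists b y, R ((x, b), y)].
have Dfin : finite_set (~` D).
  apply: contrapT => /infinite_inj_nat[g g_inj gD].
  (* a bijection between range g * bool and range g *)
  pose Q : set ((K * bool) * K) :=
    [set u | exists n (b : bool), u = ((g n, b), g (b + n.*2)%N)].
  have RnD x b y n : R ((x, b), y) -> x = g n -> False.
    by move=> Rx xE; apply: (gD n); rewrite -xE; exists b, y.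
  have RnD' x b y n : R ((x, b), y) -> y = g n -> False.
    by move=> /Rd[z Ry] yE; apply: RnD Ry yE.
  apply: (Rmax (R `|` Q)).
    split; first by move=> u Ru; left.
    move=> /(_ ((g 0, true), g 1)) RQR.
    suff Rx : R ((g 0, true), g 1) by apply: RnD Rx erefl.
    by apply: RQR; right; exists 0, true.
  split.
  - move=> [x b] y y' [Ry|[n [c [xE bE ->]]]].
      move=> [|[n [c [xE _ _]]]]; first exact: Rf Ry.
      by have := RnD _ _ _ _ Ry xE.
    move=> [Ry|[n' [c' [xE' bE' ->]]]].
      by have := RnD _ _ _ _ Ry xE.
    by move: xE'; rewrite xE -bE -bE' => /g_inj ->.
  - move=> [x b] [x' b'] y [Ry|[n [c [-> -> yE]]]].
      move=> [|[n [c [_ _ yE]]]]; first exact: Ri Ry.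
      by have := RnD' _ _ _ _ Ry yE.
    move=> [Ry|[n' [c' [-> -> yE']]]].
      by have := RnD' _ _ _ _ Ry yE.
    by move: yE'; rewrite yE => /g_inj/bit_double_inj[-> ->].
  - move=> x b c y [/(Rb _ _ c)[z Rz]|[n [c' [-> _ _]]]].
      by exists z; left.
    by exists (g (c + n.*2)%N); right; exists n, c.
  - move=> x b y [/Rd[z Rz]|[n [c' [_ _ ->]]]].
      by exists z; left.
    by exists (g (true + (c' + n.*2).*2)%N); right; exists (c' + n.*2)%N, true.
have [a a_inj] := inj_add_nat Kinf.
have /countable_injP[h h_inj] := finite_set_countable Dfin.
have Rex x b : D x -> exists y, R ((x, b), y).
  by move=> [c [y /(Rb _ _ b)]].
pose code (p : K * bool) : K + nat :=
  if pselect (D p.1) is left Dx then inl (sval (cid (Rex _ p.2 Dx)))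
  else inr (p.2 + (h p.1).*2)%N.
exists (a \o code); apply: inj_comp a_inj _ => -[x b] [y c]; rewrite /code.
case: pselect => [Dx|nDx]; case: pselect => [Dy|nDy] //=.
  by case: cid => u Ru; case: cid => v /= /[swap] -[<-]; apply: Ri.
by move=> [/bit_double_inj[-> /h_inj->]] //; exact: mem_set.
Qed.

Lemma card_leU (T K : Type) (A B : set T) : infinite_set [set: K] ->
  A #<= [set: K] -> B #<= [set: K] -> A `|` B #<= [set: K].
Proof.
move=> Kinf; have [f f_inj] := inj_mul_bool Kinf.
elim/Ppointed: K => K in Kinf f f_inj *.
  by have [x] := infinite_setN0 Kinf; have := no x.
move=> /pcard_injP[a a_inj] /pcard_injP[b b_inj]; apply/pcard_injP.
exists (fun x => if pselect (A x) then f (a x, true) else f (b x, false)).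
move=> x y; rewrite !inE => ABx ABy.
case: pselect => Ax; case: pselect => Ay /f_inj[] //.
  by apply: a_inj; exact: mem_set.
have [Bx By] : B x /\ B y by case: ABx => // Bx; case: ABy.
by apply: b_inj; exact: mem_set.
Qed.
(** * Substitution *)

Section Substitution.
Variable L : language.

Fixpoint tsubst (V W : Type) (s : V -> term L W) (t : term L V) : term L W :=
  match t with
  | Var x => s x
  | App f ts => App (fun k => tsubst s (ts k))
  end.

Definition tren (V W : Type) (h : V -> W) : term L V -> term L W :=
  tsubst (fun x => Var L (h x)).

Definition up (V W : Type) (s : V -> term L W) (o : option V) : term L (option W) :=
  if o is Some x then tren Some (s x) else Var L None.

Fixpoint subst (V : Type) (phi : formula L V) (W : Type) (s : V -> term L W) :
    formula L W :=
  match phi with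
  | Bot => fun=> Bot
  | Eq t u => fun s => Eq (tsubst s t) (tsubst s u)
  | Rel r ts => fun s => Rel (fun k => tsubst s (ts k))
  | Imp phi psi => fun s => Imp (subst phi s) (subst psi s)
  | All phi => fun s => All (subst phi (up s))
  end s.

Definition ren (V W : Type) (h : V -> W) (phi : formula L V) : formula L W :=
  subst phi (fun x => Var L (h x)).

Variable S : structure L.

Lemma eval_tsubst (V W : Type) (s : V -> term L W) t (v : W -> S) :
  eval v (tsubst s t) = eval (fun x => eval v (s x)) t.
Proof. by elim: t => //= f ts IH; congr finterp; exact: funext. Qed.

Lemma sat_subst (V : Type) (phi : formula L V) :
  forall (W : Type) (s : V -> term L W) v,
  sat (S := S) (subst phi s) v <-> sat phi (fun x => eval v (s x)).
Proof.
elim: phi => {V} [V|V t u|V r ts|V phi IH1 psi IH2|V phi IH] W s v //=.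
- by rewrite !eval_tsubst.
- suff -> : (fun k => eval v (tsubst s (ts k))) =
            (fun k => eval (fun x => eval v (s x)) (ts k)) by [].
  by apply: funext => k; rewrite eval_tsubst.
- by rewrite IH1 IH2.
- split=> sphi a; have := sphi a; rewrite IH;
    congr (sat phi _); apply: funext => -[x|] //=; rewrite /tren eval_tsubst //.
Qed.

Lemma eval_tren (V W : Type) (h : V -> W) t (v : W -> S) :
  eval v (tren h t) = eval (v \o h) t.
Proof. exact: eval_tsubst. Qed.

Lemma sat_ren (V W : Type) (h : V -> W) phi (v : W -> S) :
  sat (ren h phi) v <-> sat phi (v \o h).
Proof. exact: sat_subst. Qed.

End Substitution.

Lemma glue_comp (V A S S' : Type) (h : S -> S') (x : V -> S) (f : A -> S) :
  h \o glue x f = glue (h \o x) (h \o f).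
Proof. by apply: funext => -[]. Qed.

(** * Derived connectives *)

Section Connectives.
Variable L : language.

Definition Top (V : Type) : formula L V := Imp Bot Bot.
Definition And (V : Type) (phi psi : formula L V) := Not (Imp phi (Not psi)).
Definition Iff (V : Type) (phi psi : formula L V) := And (Imp phi psi) (Imp psi phi).
Definition Conj (V : Type) (s : seq (formula L V)) := foldr (@And V) (Top V) s.

Definition bind_last (k : nat) (V : Type) (u : 'I_k.+1 + V) : option ('I_k + V) :=
  match u with
  | inl i => if unlift ord0 i is Some i' then Some (inl i') else None
  | inr x => Some (inr x)
  end.

Definition absurd_ord (X : Type) (i : 'I_0) : X := False_rect X (notF (ltn_ord i)).

Fixpoint ForallN (k : nat) (V : Type) : formula L ('I_k + V) -> formula L V :=
  match k with
  | 0 => ren (fun u : 'I_0 + V =>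
                match u with inl i => absurd_ord V i | inr x => x end)
  | k'.+1 => fun phi => ForallN (All (ren (@bind_last k' V) phi))
  end.

Definition Forall (W : finType) (V : Type) (phi : formula L (W + V)) : formula L V :=
  ForallN (ren (glue (inl \o enum_rank) inr) phi).

Definition Exists (W : finType) (V : Type) (phi : formula L (W + V)) : formula L V :=
  Not (Forall (Not phi)).

Variable S : structure L.

Lemma sat_Not (V : Type) (phi : formula L V) (v : V -> S) :
  sat (Not phi) v <-> ~ sat phi v.
Proof. by []. Qed.

Lemma sat_Imp (V : Type) (phi psi : formula L V) (v : V -> S) :
  sat (Imp phi psi) v <-> (sat phi v -> sat psi v).
Proof. by []. Qed.

Lemma sat_All (V : Type) (phi : formula L (option V)) (v : V -> S) :
  sat (All phi) v <-> forall a, sat phi (fun o => if o is Some x then v x else a).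
Proof. by []. Qed.

Lemma sat_And (V : Type) (phi psi : formula L V) (v : V -> S) :
  sat (And phi psi) v <-> sat phi v /\ sat psi v.
Proof.
split=> [/= h|[p q] h]; last exact: h p q.
split; apply: contrapT => nh; apply: h => // p q; exact: nh.
Qed.

Lemma sat_Iff (V : Type) (phi psi : formula L V) (v : V -> S) :
  sat (Iff phi psi) v <-> (sat phi v <-> sat psi v).
Proof. by rewrite sat_And. Qed.

Lemma sat_Conj (V : Type) (s : seq {classic (formula L V)}) (v : V -> S) :
  sat (Conj s) v <-> forall phi, phi \in s -> sat phi v.
Proof.
elim: s => [|phi s IH]; first by split=> [_ phi|_ []//]; rewrite in_nil.
rewrite sat_And IH; split=> [[p q] psi|h].
  by rewrite inE => /orP[/eqP -> //|]; exact: q.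
by split=> [|psi ps]; apply: h; rewrite inE ?eqxx// ps orbT.
Qed.

Lemma sat_ForallN k (V : Type) (phi : formula L ('I_k + V)) (v : V -> S) :
  sat (ForallN phi) v <-> forall a, sat phi (glue a v).
Proof.
elim: k phi => [|k IH] phi; rewrite [ForallN _]/=.
  rewrite sat_ren; set w := v \o _.
  suff wE a : glue a v = w by split=> [h a|/(_ (absurd_ord S))]; rewrite wE.
  by apply: funext => -[i|x] //; have := ltn_ord i.
rewrite IH; split=> h a; last first.
  rewrite sat_All => c; rewrite sat_ren.
  have := h (fun i => if unlift ord0 i is Some i' then a i' else c).
  congr (sat phi _); apply: funext => -[i|x] //=.
  by case: unliftP.
have /sat_All/(_ (a ord0)) := h (fun i => a (lift ord0 i)); rewrite sat_ren.
congr (sat phi _); apply: funext => -[i|x] //=.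
by case: unliftP => [j|] ->.
Qed.

Lemma sat_Forall (W : finType) (V : Type) (phi : formula L (W + V)) (v : V -> S) :
  sat (Forall phi) v <-> forall a, sat phi (glue a v).
Proof.
rewrite sat_ForallN; split=> h a.
  have := h (a \o enum_val); rewrite sat_ren; congr (sat phi _).
  by apply: funext => -[w|x] //=; rewrite enum_rankK.
rewrite sat_ren; have := h (a \o enum_rank); congr (sat phi _).
by apply: funext => -[].
Qed.

Lemma sat_Exists (W : finType) (V : Type) (phi : formula L (W + V)) (v : V -> S) :
  sat (Exists phi) v <-> exists a, sat phi (glue a v).
Proof.
rewrite /Exists sat_Not sat_Forall; split=> [h|[a p] h]; last exact: h p.
by apply: contrapT => nh; apply: h => a p; apply: nh; exists a.
Qed.

End Connectives.

(** * Finite supports *)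

Section Support.
Variable L : language.

(** Variables are split by [g] into those, in [V], that are to be made finitely
    many, and those, in [B], that are left alone; under a quantifier the bound
    variable goes to [B]. The conclusion is semantic, which avoids identities
    between iterated substitutions. *)
Lemma tsupport_fam n (X : Type) (ts : 'I_n -> term L X) (V B : Type) (g : X -> V + B) :
  (forall k, exists (W : finType) (h : W -> V) (t' : term L (W + B)),
    forall (S : structure L) (v : V -> S) (b : B -> S),
      eval (glue v b \o g) (ts k) = eval (glue (v \o h) b) t') ->
  exists (W : finType) (h : W -> V) (ts' : 'I_n -> term L (W + B)),
  forall (S : structure L) (v : V -> S) (b : B -> S) k,
    eval (glue v b \o g) (ts k) = eval (glue (v \o h) b) (ts' k).
Proof.
move=> IH.
have /choice[F FE] k : exists q : {W : finType & ((W -> V) * term L (W + B))%type},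
    forall (S : structure L) (v : V -> S) (b : B -> S),
    eval (glue v b \o g) (ts k) = eval (glue (v \o (projT2 q).1) b) (projT2 q).2.
  by have [W [h [t' E]]] := IH k; exists (existT _ W (h, t')).
exists {k : 'I_n & projT1 (F k)},
  (fun u => (projT2 (F (tag u))).1 (tagged u)),
  (fun k => tren (glue (inl \o Tagged (fun k => projT1 (F k)) (i := k)) inr)
     (projT2 (F k)).2) => S v b k /=.
rewrite FE eval_tren.
by congr (eval _ _); apply: funext => -[].
Qed.

Lemma tsupport (X : Type) (t : term L X) (V B : Type) (g : X -> V + B) :
  exists (W : finType) (h : W -> V) (t' : term L (W + B)),
  forall (S : structure L) (v : V -> S) (b : B -> S),
    eval (glue v b \o g) t = eval (glue (v \o h) b) t'.
Proof.
elim: t => [x|f ts IH].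
  case gx : (g x) => [y|c].
    by exists unit, (fun=> y), (Var L (inl tt)) => S v b /=; rewrite gx.
  by exists void, (@of_void V), (Var L (inr c)) => S v b /=; rewrite gx.
have [W [h [ts' E]]] := tsupport_fam IH.
by exists W, h, (App ts') => S v b /=; congr finterp; apply: funext => k; exact: E.
Qed.

Lemma support (X : Type) (phi : formula L X) : forall (V B : Type) (g : X -> V + B),
  exists (W : finType) (h : W -> V) (psi : formula L (W + B)),
  forall (S : structure L) (v : V -> S) (b : B -> S),
    sat phi (glue v b \o g) <-> sat psi (glue (v \o h) b).
Proof.
elim: phi => {X} [X|X t u|X r ts|X phi IH1 psi IH2|X phi IH] V B g.
- by exists void, (@of_void V), Bot.
- have [W1 [h1 [t1 E1]]] := tsupport t g.
  have [W2 [h2 [t2 E2]]] := tsupport u g.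
  exists (W1 + W2)%type, (glue h1 h2),
    (Eq (tren (glue (inl \o inl) inr) t1) (tren (glue (inl \o inr) inr) t2)).
  move=> S v b /=; rewrite E1 E2 !eval_tren.
  have -> : glue (v \o glue h1 h2) b \o glue (inl \o inl) inr = glue (v \o h1) b.
    by apply: funext => -[].
  have -> // : glue (v \o glue h1 h2) b \o glue (inl \o inr) inr = glue (v \o h2) b.
  by apply: funext => -[].
- have [W [h [ts' E]]] := tsupport_fam (fun k => tsupport (ts k) g).
  exists W, h, (Rel ts') => S v b /=.
  suff -> : (fun k => eval (glue v b \o g) (ts k)) =
            (fun k => eval (glue (v \o h) b) (ts' k)) by [].
  by apply: funext => k; exact: E.
- have [W1 [h1 [p1 E1]]] := IH1 V B g.
  have [W2 [h2 [p2 E2]]] := IH2 V B g.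
  exists (W1 + W2)%type, (glue h1 h2),
    (Imp (ren (glue (inl \o inl) inr) p1) (ren (glue (inl \o inr) inr) p2)).
  move=> S v b /=; rewrite E1 E2 !sat_ren.
  have -> : glue (v \o glue h1 h2) b \o glue (inl \o inl) inr = glue (v \o h1) b.
    by apply: funext => -[].
  have -> // : glue (v \o glue h1 h2) b \o glue (inl \o inr) inr = glue (v \o h2) b.
  by apply: funext => -[].
- pose g' o := match o with
    | None => inr None
    | Some x => match g x with inl y => inl y | inr c => inr (Some c) end
    end.
  have [W [h [psi E]]] := IH V (option B) g'.
  exists W, h, (All (ren (fun u => match u with
    | inl w => Some (inl w) | inr None => None
    | inr (Some c) => Some (inr c) end) psi)) => S v b /=.
  split=> sphi a; have := sphi a; rewrite sat_ren.
    have -> : (fun o => if o is Some x then (glue v b \o g) x else a) =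
        glue v (fun o => if o is Some c then b c else a) \o g'.
      by apply: funext => -[x|] //=; case: (g x).
    by rewrite E; congr (sat psi _); apply: funext => -[w|[c|]].
  have -> : (fun o => if o is Some x then (glue v b \o g) x else a) =
        glue v (fun o => if o is Some c then b c else a) \o g'.
    by apply: funext => -[x|] //=; case: (g x).
  by rewrite E; congr (sat psi _); apply: funext => -[w|[c|]].
Qed.

Lemma support_ord (X : Type) (phi : formula L X) (V B : Type) (g : X -> V + B) :
  exists k (h : 'I_k -> V) (psi : formula L ('I_k + B)),
  forall (S : structure L) (v : V -> S) (b : B -> S),
    sat phi (glue v b \o g) <-> sat psi (glue (v \o h) b).
Proof.
have [W [h [psi E]]] := support phi g.
exists #|W|, (h \o enum_val), (ren (glue (inl \o enum_rank) inr) psi) => S v b.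
rewrite E sat_ren.
have -> // : glue (v \o h) b =
  glue (v \o (h \o enum_val)) b \o glue (inl \o enum_rank) inr.
by apply: funext => -[w|c] //=; rewrite enum_rankK.
Qed.

Lemma support_closed (V : Type) (phi : formula L V) :
  exists k (h : 'I_k -> V) (psi : formula L 'I_k),
  forall (S : structure L) (v : V -> S), sat phi v <-> sat psi (v \o h).
Proof.
have [k [h [psi E]]] := support_ord phi (@inl V void).
exists k, h, (ren (glue id (@of_void _)) psi) => S v.
rewrite sat_ren.
have -> : (v \o h) \o glue id (@of_void _) = glue (v \o h) (of_void S).
  by apply: funext => -[].
by rewrite -E.
Qed.

End Support.
(** * Relational expansions *)

Section Expansion.
Variables (L : language) (R : Type) (ra : R -> nat).

Let L2 := @Language (fsym L) R (@farity L) ra.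

Fixpoint tlift (V : Type) (t : term L V) : term L2 V :=
  match t with
  | Var x => Var L2 x
  | App f ts => @App L2 V f (fun k => tlift (ts k))
  end.

Fixpoint tback (V : Type) (t : term L2 V) : term L V :=
  match t with
  | Var x => Var L x
  | App f ts => @App L V f (fun k => tback (ts k))
  end.

Variables (r : rsym L -> R) (rE : forall x, ra (r x) = rarity x).

Fixpoint flift (V : Type) (phi : formula L V) : formula L2 V :=
  match phi with
  | Bot => Bot
  | Eq t u => Eq (tlift t) (tlift u)
  | Rel x ts => @Rel L2 V (r x) (fun k => tlift (ts (cast_ord (rE x) k)))
  | Imp phi psi => Imp (flift phi) (flift psi)
  | All phi => All (flift phi)
  end.

Variables (S : structure L) (rI : forall s : R, ('I_(ra s) -> S) -> Prop).

Let S2 : structure L2 :=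
  @Structure L2 S (carrier_inhabited S) (fun f => @finterp L S f) rI.

Lemma eval_tlift (V : Type) (t : term L V) (v : V -> S) :
  @eval L2 S2 V v (tlift t) = eval v t.
Proof. by elim: t => //= f ts IH; congr (finterp _); exact: funext. Qed.

Lemma eval_tback (V : Type) (t : term L2 V) (v : V -> S) :
  eval v (tback t) = @eval L2 S2 V v t.
Proof.
by elim: t => //= f ts IH; congr (@finterp L S f _); exact: funext.
Qed.

Hypothesis rIE : forall x w, rI (s := r x) (w \o cast_ord (rE x)) <-> rinterp w.

Lemma sat_flift (V : Type) (phi : formula L V) (v : V -> S) :
  @sat L2 S2 V (flift phi) v <-> sat phi v.
Proof.
elim: phi v => {V} [V|V t u|V x ts|V phi IH1 psi IH2|V phi IH] v //=.
- by rewrite !eval_tlift.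
- rewrite -rIE.
  suff -> : (fun k => @eval L2 S2 V v (tlift (ts (cast_ord (rE x) k)))) =
            (fun k => eval v (ts k)) \o cast_ord (rE x) by [].
  by apply: funext => k; exact: eval_tlift.
- by rewrite IH1 IH2.
- by split=> h a; apply/IH; exact: h.
Qed.

End Expansion.

Lemma comp_cast_ord_id (n : nat) (S : Type) (w : 'I_n -> S) (E : n = n) :
  w \o cast_ord E = w.
Proof. by apply: funext => k /=; rewrite cast_ord_id. Qed.

Section Embeddings.
Variables (L : language).

Lemma elementary_embedding (S1 S2 : structure L) (h : S1 -> S2) :
  elementary S1 S2 h -> embedding h.
Proof.
move=> hE; split.
- move=> x y xy.
  apply/(hE bool (Eq (Var L true) (Var L false)) (fun b => if b then x else y)).
  by [].
- move=> f x.
  pose v (u : option 'I_(farity f)) := if u is Some k then x k else finterp x.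
  by have [/(_ erefl)/= <-] := hE _ (Eq (App (fun k => Var L (Some k))) (Var L None)) v.
- by move=> r x; exact: (hE _ (Rel (fun k => Var L k)) x).
Qed.

Lemma eval_embedding (S1 S2 : structure L) (h : S1 -> S2) : embedding h ->
  forall (V : Type) (t : term L V) (v : V -> S1), h (eval v t) = eval (h \o v) t.
Proof.
move=> hE V t v; elim: t => //= f ts IH.
by rewrite embedding_fun//; congr finterp; exact: funext.
Qed.

End Embeddings.

(** * From the Shelah expansion to the pair *)

Section Translation.
Variables (L : language) (D : Type).

Let LSh := shelah_lang L D.
Let LP := pair_lang L.

Definition incl : forall V : Type, formula L V -> formula LSh V :=
  @flift L (rsym L + {n : nat & formula L ('I_n + D)})%type
    (fun s => match s with inl r => rarity r | inr R => projT1 R end)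
    inl (fun=> erefl).

Definition pincl : forall V : Type, formula L V -> formula LP V :=
  @flift L (option (rsym L)) (fun o => if o is Some r then rarity r else 1%N)
    Some (fun=> erefl).

Definition pterm (V : Type) (t : term LSh V) : term LP (V + D) :=
  tren inl (tlift (fun o : option (rsym L) => if o is Some r then rarity r else 1%N)
    (tback t)).

(** Relativization to P; the symbol of phi(x, d) becomes phi(x, d) itself, whose
    quantifiers range over N. *)
Fixpoint tr (V : Type) (chi : formula LSh V) : formula LP (V + D) :=
  match chi with
  | Bot => Bot
  | Eq t u => Eq (pterm t) (pterm u)
  | Rel s ts =>
      match s return ('I_(@rarity LSh s) -> term LSh V) -> formula LP (V + D) with
      | inl r => fun ts => @Rel LP _ (Some r) (fun k => pterm (ts k))
      | inr R => fun ts => subst (pincl (projT2 R))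
          (glue (fun k => pterm (ts k)) (fun d => Var LP (inr d)))
      end ts
  | Imp phi psi => Imp (tr phi) (tr psi)
  | All phi => All (Imp (@Rel LP _ None (fun=> Var LP None))
      (ren (fun u => match u with
        | inl (Some x) => Some (inl x)
        | inl None => None
        | inr d => Some (inr d) end) (tr phi)))
  end.

Lemma sat_incl (M N : structure L) (i : M -> N) (e : D -> N) (V : Type)
    (phi : formula L V) (v : V -> M) :
  @sat LSh (shelah_struct i e) V (incl phi) v <-> sat phi v.
Proof.
by apply: sat_flift => x w; rewrite comp_cast_ord_id.
Qed.

Lemma sat_pincl (M N : structure L) (i : M -> N) (V : Type)
    (phi : formula L V) (v : V -> N) :
  @sat LP (pair_struct i) V (pincl phi) v <-> sat phi v.
Proof.
by apply: sat_flift => x w; rewrite comp_cast_ord_id.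
Qed.

Section Semantics.
Variables (M N : structure L) (i : M -> N) (i_emb : embedding i) (e : D -> N).

Lemma eval_pterm (V : Type) (t : term LSh V) (v : V -> M) :
  @eval LP (pair_struct i) _ (glue (i \o v) e) (pterm t) =
  i (@eval LSh (shelah_struct i e) V v t).
Proof.
rewrite /pterm eval_tren; have -> : glue (i \o v) e \o inl = i \o v by [].
rewrite (eval_tlift _ (tback t)) -eval_embedding//; congr i.
exact: (@eval_tback L _ _ M (fun s => @rinterp _ (shelah_struct i e) s)).
Qed.

Lemma sat_tr (V : Type) (chi : formula LSh V) (v : V -> M) :
  @sat LSh (shelah_struct i e) V chi v <->
  @sat LP (pair_struct i) _ (tr chi) (glue (i \o v) e).
Proof.
elim: chi v => {V} [V|V t u|V s ts|V phi IH1 psi IH2|V phi IH] v //.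
- rewrite /= !eval_pterm; split=> [->//|]; exact: embedding_inj.
- case: s ts => [r|R] ts /=.
    rewrite (embedding_rel i_emb).
    suff -> : (fun k => @eval LP (pair_struct i) _ (glue (i \o v) e) (pterm (ts k))) =
      i \o (fun k => @eval LSh (shelah_struct i e) V v (ts k)) by [].
    by apply: funext => k; exact: eval_pterm.
  rewrite sat_subst sat_pincl.
  suff -> : (fun x => @eval LP (pair_struct i) _ (glue (i \o v) e)
      (glue (fun k => pterm (ts k)) (fun d => Var LP (inr d)) x)) =
      glue (i \o (fun k => @eval LSh (shelah_struct i e) V v (ts k))) e by [].
  by apply: funext => -[k|d] //=; exact: eval_pterm.
- by rewrite /= IH1 IH2.
- have E a : (fun o : option (V + D) => if o is Some x then glue (i \o v) e x else i a)
        \o (fun u => match u with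
        | inl (Some x) => Some (inl x)
        | inl None => None
        | inr d => Some (inr d) end) =
      glue (i \o (fun o : option V => if o is Some x then v x else a)) e.
    by apply: funext => -[[x|]|d].
  rewrite [tr _]/= !sat_All; split=> h a.
    rewrite sat_Imp sat_ren => -[b _ bE]; rewrite /= in bE.
    by rewrite -bE E -IH; exact: h.
  have := h (i a); rewrite sat_Imp sat_ren E -IH; apply.
  by exists a.
Qed.

End Semantics.
End Translation.
(** * Transfer and compactness *)

Lemma elementary_forall (L : language) (S1 S2 : structure L) (h : S1 -> S2)
    (W : finType) (A : Type) (f : A -> S1) (phi : formula L (W + A)) :
  elementary S1 S2 h ->
  (forall x, sat phi (glue x f)) <-> (forall x, sat phi (glue x (h \o f))).
Proof. by move=> hE; rewrite -!sat_Forall; exact: hE. Qed.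

Lemma elementary_exists (L : language) (S1 S2 : structure L) (h : S1 -> S2)
    (W : finType) (A : Type) (f : A -> S1) (phi : formula L (W + A)) :
  elementary S1 S2 h ->
  (exists x, sat phi (glue x f)) <-> (exists x, sat phi (glue x (h \o f))).
Proof. by move=> hE; rewrite -!sat_Exists; exact: hE. Qed.

Lemma elementary_valid (L : language) (S1 S2 : structure L) (h : S1 -> S2)
    (W : finType) (phi : formula L W) : elementary S1 S2 h ->
  (forall x : W -> S1, sat phi x) -> forall x : W -> S2, sat phi x.
Proof.
move=> hE phi1 x.
have [+ _] := @elementary_forall _ _ _ h W void (of_void _) (ren inl phi) hE.
move=> /(_ (fun x => (sat_ren _ _ _).2 (phi1 x)))/(_ x).
by rewrite sat_ren.
Qed.

Lemma finite_sub_range (I T : Type) (r : I -> T) (F : set T) :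
  finite_set F -> F `<=` range r ->
  exists s : seq {classic I}, forall x, F x -> exists2 t, t \in s & x = r t.
Proof.
move=> Ffin Fr; have /finite_seqP[l lE] : finite_set (F : set {classic T}) by [].
have {}lE x : F x <-> x \in (l : seq {classic T}) by rewrite lE.
elim: l F {Ffin} Fr lE => [|y l IH] F Fr lE.
  by exists [::] => x /lE.
have Fy : F y by apply/lE; exact: mem_head.
have [t _ ty] := Fr _ Fy.
have [x lx|x|s sE] := IH [set` l].
- by apply: Fr; apply/lE; exact: (@mem_behead {classic T} (y :: l)).
- by [].
exists (t :: s) => x /lE; rewrite [_ \in _]in_cons => /orP[/eqP ->|].
  by exists t => //; exact: mem_head.
by move=> /sE[u us ->]; exists u; rewrite // inE us orbT.
Qed.

(** The relation symbol of phi(x, d) applied to its own variables. *)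
Definition named (L : language) (D : Type) (W : finType) (phi : formula L (W + D)) :
    formula (shelah_lang L D) W :=
  @Rel (shelah_lang L D) W
    (inr (existT _ #|W| (ren (glue (inl \o enum_rank) inr) phi)))
    (fun k => Var (shelah_lang L D) (enum_val k)).

Lemma sat_named (L : language) (D : Type) (M N : structure L) (i : M -> N)
    (e : D -> N) (W : finType) (phi : formula L (W + D)) (x : W -> M) :
  @sat _ (shelah_struct i e) _ (named phi) x <-> sat phi (glue (i \o x) e).
Proof.
rewrite /= sat_ren.
suff -> : glue (i \o (fun k => x (enum_val k))) e \o glue (inl \o enum_rank) inr =
  glue (i \o x) e by [].
by apply: funext => -[w|d] //=; rewrite enum_rankK.
Qed.

Section Shelah.
Variables (L : language) (M N : structure L) (i : M -> N).
Hypothesis i_elem : elementary M N i.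
Hypothesis N_sat : succ_saturated M N.
Variables (N' M' : structure L) (i' : M' -> N').
Hypothesis i'_emb : embedding i'.
Variable e : N -> N'.
Hypothesis e_elem : elementary (pair_struct i) (pair_struct i') e.
Variable j : M -> M'.
Hypothesis j_comm : forall m : M, i' (j m) = e (i m).

Let MSh := shelah_struct (D := N) i idfun.
Let MSh' := shelah_struct (D := N) i' e.

Lemma shelah_elementary : elementary MSh MSh' j.
Proof.
move=> V chi v; rewrite !sat_tr//; last exact: elementary_embedding.
rewrite e_elem glue_comp.
suff -> : e \o (i \o v) = i' \o (j \o v) by [].
by apply: funext => x /=; rewrite j_comm.
Qed.

Lemma big_elementary : elementary N N' e.
Proof.
move=> V phi v.
by rewrite -(sat_pincl i) -(sat_pincl i'); exact: e_elem.
Qed.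

Lemma small_elementary : elementary M M' j.
Proof.
move=> V phi v; rewrite -(sat_incl i idfun) -(sat_incl i' e).
exact: shelah_elementary.
Qed.

(** Each L-formula phi without parameters names a symbol R_phi, evaluated in N;
    since M is elementary in N the sentence (phi iff R_phi) holds in M^Sh, hence
    in its extension on M'. *)
Lemma side_elementary : elementary M' N' i'.
Proof.
move=> V phi v; have [k [h [psi E]]] := support_closed phi.
have IffE (D : Type) (M1 N1 : structure L) (i1 : M1 -> N1) (e1 : D -> N1) x :
    @sat _ (shelah_struct i1 e1) _ (Iff (incl D psi) (named (ren inl psi))) x <->
    (sat psi x <-> sat psi (i1 \o x)).
  by rewrite sat_Iff sat_incl sat_named sat_ren.
rewrite !E; apply/(IffE _ _ _ _ e); move: (v \o h).
by apply: (elementary_valid shelah_elementary) => x; apply/IffE; exact: i_elem.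
Qed.

Variable K : Type.
Hypothesis N_le_K : [set: N] #<= [set: K].
Hypothesis N'_sat : succ_saturated K (pair_struct i').

(** Smallness as a condition of compactness: if [K] is finite then so is M', and
    all types over all of M' are realized. The first disjunct makes finite
    unions of small sets small in this case too. *)
Definition small (X : set M') := finite_set [set: K] \/ X #<= [set: K].

Lemma smallU X Y : small X -> small Y -> small (X `|` Y).
Proof.
have [Kfin|Kinf] := pselect (finite_set [set: K]); first by left.
by move=> [//|XK] [//|YK]; right; exact: card_leU.
Qed.

Lemma small_sub X Y : X `<=` Y -> small Y -> small X.
Proof.
move=> XY [?|YK]; [by left|right].
exact: card_le_trans (subset_card_le XY) YK.
Qed.

Lemma small_range (A : Type) (f : A -> M') : [set: A] #<= [set: K] -> small (range f).
Proof. by move=> AK; right; exact: card_le_trans (card_image_le _ _) AK. Qed.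

Lemma small_countable (X : set M') : countable X -> small X.
Proof.
move=> Xc; have [Kfin|/infiniteP Kinf] := pselect (finite_set [set: K]).
  by left.
by right; exact: card_le_trans Xc Kinf.
Qed.

Lemma base_card : [set: M] #<= [set: K].
Proof.
apply: card_le_trans N_le_K.
apply: inj_card_le.
have iinj : {in [set: M] &, injective i}.
  by move=> x y _ _; exact: (embedding_inj (elementary_embedding i_elem)).
have /Pinj[f _] := iinj.
have /injPfun[g _] : set_fun [set: M] [set: N] f by [].
exact: g.
Qed.

Lemma small_base : small (range j).
Proof. exact: small_range base_card. Qed.

Lemma base_onto : finite_set [set: K] -> forall y, exists m, y = j m.
Proof.
move=> Kfin y.
have /finite_seqP[s sE] : finite_set [set: {classic M}].
  exact: card_le_finite base_card Kfin.
pose phi : formula L (unit + M) :=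
  Not (Conj [seq Not (Eq (Var L (inl tt)) (Var L (inr m))) | m <- s]).
have [h _] := elementary_forall id phi small_elementary.
apply: contrapT => ny; have: sat phi (glue (fun=> y) (j \o id)).
  apply: h => x; rewrite sat_Not sat_Conj => hx.
  have xs : (x tt : {classic M}) \in s.
    by have: [set: {classic M}] (x tt) by []; rewrite sE.
  by have /(_ erefl) := hx _ (map_f _ xs).
apply; apply/sat_Conj => _ /mapP[m _ ->]; rewrite sat_Not => /= ym.
by apply: ny; exists m.
Qed.

(** Translated to the pair, the type mentions the parameters from [A] and those
    from N that occur in the symbols, which together are at most |K| many. *)
Lemma compactness (W : finType) (A : Type) (f : A -> M') (I : Type)
    (X : I -> formula (shelah_lang L N) (W + A)) :
  small (range f) ->
  (forall s : seq {classic I}, exists x : W -> M',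
    forall t : I, (t : {classic I}) \in s -> @sat _ MSh' _ (X t) (glue x f)) ->
  exists x : W -> M', forall t, @sat _ MSh' _ (X t) (glue x f).
Proof.
move=> fK Xs; have [Kfin|Kinf] := pselect (finite_set [set: K]).
  apply: contrapT => /forallNP nX.
  have /choice[t tP] x : exists t, ~ @sat _ MSh' _ (X t) (glue x f).
    by apply/existsNP.
  have /finite_seqP[s sE] : finite_set [set: {classic M}].
    exact: card_le_finite base_card Kfin.
  have [m0] := carrier_inhabited M.
  pose g (u : {ffun W -> 'I_(size s)}) w := j (nth (m0 : {classic M}) s (u w)).
  have [x xP] := Xs [seq t (g u) | u <- enum {ffun W -> 'I_(size s)}].
  have [u ux] : exists u, g u = x.
    have /choice[y yE] w := base_onto Kfin (x w).
    have ys w : (index (y w : {classic M}) s < size s)%N.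
      by rewrite index_mem; have: [set: {classic M}] (y w) by []; rewrite sE.
    exists [ffun w => Ordinal (ys w)]; apply: funext => w.
    by rewrite /g ffunE /= nth_index ?yE// -index_mem.
  by apply: (tP x); apply: xP; apply/mapP; exists u; rewrite ?mem_enum ?ux.
have {}fK : range f #<= [set: K] by case: fK.
pose r (u : (W + A) + N) : 'I_#|W| + (A + N) := match u with
  | inl (inl w) => inl (enum_rank w)
  | inl (inr a) => inr (inl a)
  | inr d => inr (inr d) end.
pose rho (t : I + 'I_#|W|) : formula (pair_lang L) ('I_#|W| + (A + N)) := match t with
  | inl t => ren r (tr (X t))
  | inr k => @Rel (pair_lang L) _ None (fun=> Var (pair_lang L) (inl k)) end.
have rE (x : W -> M') :
    glue (i' \o (x \o enum_val)) (glue (i' \o f) e) \o r = glue (i' \o glue x f) e.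
  by apply: funext => -[[w|a]|d] //=; rewrite enum_rankK.
have [|F Ffin Frho|y yP] := @N'_sat _ (glue (i' \o f) e) _ #|W| (range rho).
- apply: card_le_trans (@card_leU _ _ (i' @` range f) (range e) _ _ _).
  + apply: subset_card_le => _ [[a|d] _ <-]; last by right; exists d.
    by left; exists (f a); first by exists a.
  + exact: Kinf.
  + exact: card_le_trans (card_image_le _ _) fK.
  + exact: card_le_trans (card_image_le _ _) N_le_K.
- have [s sF] := finite_sub_range Ffin Frho.
  have [x xP] := Xs (pmap (fun t : {classic (I + 'I_#|W|)} =>
    if t is inl u then Some (u : {classic I}) else None) s).
  exists (i' \o (x \o enum_val)) => // phi /sF[[t|k] ts ->].
    rewrite /defset /= sat_ren rE -sat_tr//; apply: xP.
    by rewrite mem_pmap; apply/mapP; exists (inl t).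
  by exists (x (enum_val k)).
have {}yP t : sat (rho t) (glue y (glue (i' \o f) e)) by apply: yP; exists t.
have /choice[z zE] (k : 'I_#|W|) : exists z, i' z = y k.
  by have [z _ zE] := yP (inr k); exists z.
exists (z \o enum_rank) => t; rewrite sat_tr// -rE -sat_ren.
have -> : i' \o (z \o enum_rank \o enum_val) = y.
  by apply: funext => k /=; rewrite enum_valK zE.
exact: (yP (inl t)).
Qed.


(** * Honest definitions *)

Variable T : set (sentence L).
Hypotheses (T_NIP : NIP T) (M_T : models M T).

Lemma big_models : models N' T.
Proof.
move=> sigma Tsigma v.
have -> : v = e \o (i \o of_void M) by apply: funext.
by apply/big_elementary/i_elem; exact: M_T.
Qed.

Lemma not_shattered (W : finType) l (phi : formula L (W + 'I_l)) :
  exists k, forall a : 'I_k -> W -> N',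
  ~ forall J : {set 'I_k}, exists b : 'I_l -> N',
      forall t, sat phi (glue (a t) b) <-> t \in J.
Proof.
have [k kP] := T_NIP (ren (glue (inl \o enum_rank) inr) phi).
exists k => a /choice[b bP]; apply: (kP _ big_models).
exists (fun t => a t \o enum_val), b => t J; rewrite -bP sat_ren.
have -> // : glue (a t \o enum_val) (b J) \o glue (inl \o enum_rank) inr =
  glue (a t) (b J).
by apply: funext => -[w|d] //=; rewrite enum_rankK.
Qed.

Section Honest.
Variables (W : finType) (A : Type) (f : A -> M').
Hypothesis f_small : small (range f).
Variable phi : formula L (W + N).

Let Phi (x : W -> M') := sat phi (glue (i' \o x) e).

Let good (psi : formula L (W + M')) :=
  forall x, sat psi (glue x idfun) -> Phi x.

Definition params (s : nat -> W -> M') : nat * W + A -> M' :=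
  glue (fun u => s u.1 u.2) f.

(** For an ultrafilter [D] on the [W]-tuples of [A], [x] realizes the L-type of
    [D] over [A] and the points [s], computed in M'. *)
Definition realizes (D : set_system (W -> A)) s (x : W -> M') :=
  forall theta : formula L (W + (nat * W + A)),
    D [set a | sat theta (glue (f \o a) (params s))] ->
    sat theta (glue x (params s)).

Definition upd (s : nat -> W -> M') t x : nat -> W -> M' :=
  fun u => if u == t then x else s u.

(** [s 0, ..., s t.-1] is a Morley sequence over [A] of the type of [D], such
    that phi(s u, d) holds exactly when [eps u] does. All entries of [s] from
    [t] on are [x0], so that the parameters [params s] are determined by the
    first [t] entries. *)
Fixpoint morley D (x0 : W -> M') (eps : nat -> Prop) t s : Prop :=
  match t with
  | 0 => s = fun=> x0
  | t.+1 => exists s' x, [/\ morley D x0 eps t s', realizes D s' x,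
                             Phi x <-> eps t & s = upd s' t x]
  end.

Lemma morley_pattern D x0 eps t s : morley D x0 eps t s ->
  forall u, (u < t)%N -> Phi (s u) <-> eps u.
Proof.
elim: t s => // t IH s [s' [x [ms' _ xt ->]]] u; rewrite ltnS leq_eqVlt /upd.
by case: eqP => [-> _ //|_ /= ut]; exact: IH.
Qed.

(** Since [D] is an ultrafilter, what [s t] satisfies over the earlier entries is
    decided by which points of [A] satisfy it, and this only depends on the
    L-type of the earlier entries over [A]. *)
Lemma morley_type D x0 eps eps' t s s' : UltraFilter D ->
  morley D x0 eps t s -> morley D x0 eps' t s' ->
  forall xi : formula L (nat * W + A), sat xi (params s) <-> sat xi (params s').
Proof.
move=> DU; elim: t s s' => [s s' -> ->//|t IH z z'].
move=> [s [x [ms xs _ ->]]] [s' [x' [ms' xs' _ ->]]] xi {z z'}.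
pose r (u : nat * W + A) : W + (nat * W + A) := match u with
  | inl (v, w) => if v == t then inl w else inr (inl (v, w))
  | inr a => inr (inr a) end.
have key s0 x1 : realizes D s0 x1 ->
    sat xi (params (upd s0 t x1)) <->
    D [set a | sat (ren r xi) (glue (f \o a) (params s0))].
  move=> xr.
  have -> : params (upd s0 t x1) = glue x1 (params s0) \o r.
    apply: funext => -[[v w]|a] //=; rewrite /upd.
    by case: eqP.
  rewrite -sat_ren; split=> [sx|]; last exact: xr.
  have [//|Dn] := in_ultra_setVsetC
    [set a | sat (ren r xi) (glue (f \o a) (params s0))] DU.
  by have := xr (Not (ren r xi)) Dn; rewrite sat_Not.
rewrite (key _ _ xs) (key _ _ xs').
suff -> : [set a | sat (ren r xi) (glue (f \o a) (params s))] =
          [set a | sat (ren r xi) (glue (f \o a) (params s'))] by [].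
have E s0 a : sat (ren r xi) (glue (f \o a) (params s0)) <->
    sat (ren (glue (fun w => inr (a w)) id) (ren r xi)) (params s0).
  rewrite [X in _ <-> X]sat_ren.
  by have -> // : glue (f \o a) (params s0) = params s0 \o glue (fun w => inr (a w)) id
    by apply: funext => -[].
by apply/seteqP; split=> a h; apply/E/(IH _ _ ms ms')/E.
Qed.

Lemma filter_seq (X I : Type) (D : set_system X) (s : seq {classic I})
    (Y : I -> set X) :
  Filter D -> (forall t : {classic I}, t \in s -> D (Y t)) ->
  D [set a | forall t : {classic I}, t \in s -> Y t a].
Proof.
move=> DF; elim: s => [_|u s IH Ds].
  by apply: filterS filterT => a _ t; rewrite in_nil.
have Du : D (Y u) by apply: Ds; exact: mem_head.
have {}IH := IH (fun t ts => Ds t (@mem_behead {classic I} (u :: s) t ts)).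
apply: filterS (filterI Du IH) => a [Yu Ys] t.
by rewrite in_cons => /orP[/eqP ->//|]; exact: Ys.
Qed.

Lemma params_small s : small (range (params s)).
Proof.
apply: (@small_sub _ (range (fun u => s u.1 u.2) `|` range f)).
  by move=> _ [[u|a] _ <-]; [left; exists u|right; exists a].
apply: smallU f_small; apply: small_countable.
apply: sub_countable (card_image_le _ _) _.
exact: countableP.
Qed.

(** The type of [D] is finitely satisfiable in the points of [A] satisfying
    phi(x, d), so it is consistent with phi(x, d). It is also consistent with
    the negation, as a formula of the type contained in phi(M', d) would be one
    of those that [D] avoids. *)
Lemma morley_exists D x0 eps t : UltraFilter D ->
  D [set a | Phi (f \o a)] ->
  (forall psi, good psi -> D [set a | ~ sat psi (glue (f \o a) idfun)]) ->
  exists s, morley D x0 eps t s.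
Proof.
move=> DU DPhi Dgood; have DF : Filter D by exact: filter_filter.
elim: t => [|t [s ms]]; first by exists (fun=> x0).
suff [x xs xt] : exists2 x, realizes D s x & Phi x <-> eps t.
  by exists (upd s t x), s, x.
pose I := {theta | D [set a | sat theta (glue (f \o a) (params s))]}.
pose lit (b : Prop) (chi : formula (shelah_lang L N) W) : formula (shelah_lang L N) W :=
  if pselect b then chi else Not chi.
pose X (u : I) := And (incl N (sval u)) (ren inl (lit (eps t) (named phi))).
have litE (x : W -> M') :
    @sat _ MSh' _ (lit (eps t) (named phi)) x <-> (Phi x <-> eps t).
  by rewrite /lit; case: pselect => h; rewrite ?sat_Not sat_named /Phi; tauto.
have XE (u : I) x : @sat _ MSh' _ (X u) (glue x (params s)) <->
    sat (sval u) (glue x (params s)) /\ (Phi x <-> eps t).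
  rewrite sat_And sat_incl sat_ren.
  by have -> : glue x (params s) \o inl = x by []; rewrite litE.
have [l|x xX] := compactness (X := X) (params_small s).
  suff [x xl xt] : exists2 x, forall u : {classic I}, u \in l ->
      sat (sval u) (glue x (params s)) & Phi x <-> eps t.
    by exists x => u ul; apply/XE; split=> //; exact: xl.
  have Dl := @filter_seq _ I D l
    (fun u => [set a | sat (sval u) (glue (f \o a) (params s))])
    DF (fun u _ => svalP u).
  have [et|net] := pselect (eps t).
    have [a [Pa la]] := filter_ex (filterI DPhi Dl).
    by exists (f \o a) => //; split.
  apply: contrapT => nx.
  pose theta := Conj [seq sval u | u : {classic I} <- l].
  have thetaE x : sat theta (glue x (params s)) <->
      forall u : {classic I}, u \in l -> sat (sval u) (glue x (params s)).
    rewrite sat_Conj; split=> [h u ul|h _ /mapP[u ul ->]]; last exact: h.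
    by apply: h; apply/mapP; exists u.
  have rE x : glue x idfun \o glue inl (inr \o params s) = glue x (params s).
    by apply: funext => -[].
  have /Dgood Dn : good (ren (glue inl (inr \o params s)) theta).
    move=> x; rewrite sat_ren rE thetaE => xl; apply: contrapT => nPhi.
    by apply: nx; exists x => //; split.
  have [a [la]] := filter_ex (filterI Dl Dn).
  by apply; rewrite sat_ren rE thetaE.
have Dtop : D [set a | sat (Top L _) (glue (f \o a) (params s))].
  by apply: (filterS _ filterT) => a _ h.
exists x; last by have /XE[] := xX (exist _ (Top L _) Dtop).
by move=> theta Dtheta; have /XE[] := xX (exist _ theta Dtheta).
Qed.

(** If no psi contained in phi(M', d) covers the points of [A] in phi(M', d),
    the sets of uncovered points generate a proper filter. For [D] an
    ultrafilter above it, fix a Morley sequence s and, for each subset J of its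
    index set, another one on which phi(x, d) has pattern J. Both have the same
    L-type, so some b in N' gives phi(x, b) the pattern J on s, against NIP. *)
Lemma honest_definition : exists2 psi : formula L (W + M'),
  forall x, sat psi (glue x idfun) -> sat phi (glue (i' \o x) e) &
  forall a, sat phi (glue (i' \o (f \o a)) e) -> sat psi (glue (f \o a) idfun).
Proof.
apply: contrapT => nh.
pose F : set_system (W -> A) := [set Y | exists2 psi, good psi &
  [set a | Phi (f \o a) /\ ~ sat psi (glue (f \o a) idfun)] `<=` Y].
have FP : ProperFilter F.
  split.
    move=> [psi psig sub]; apply: nh; exists psi => // a Pa.
    by apply: contrapT => na; exact: (sub a).
  split.
  - by exists Bot.
  - move=> Y Z [psi1 g1 s1] [psi2 g2 s2]; exists (Imp (Not psi1) psi2).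
      move=> x; rewrite sat_Imp sat_Not => h.
      by have [/g1//|/h/g2] := pselect (sat psi1 (glue x idfun)).
    move=> a [Pa]; rewrite sat_Imp sat_Not => na.
    by split; [apply: s1|apply: s2]; split=> // h; apply: na.
  - by move=> Y Z YZ [psi g s]; exists psi => //; exact: subset_trans YZ.
have [D [DU FD]] := ultraFilterLemma FP.
have DPhi : D [set a | Phi (f \o a)].
  by apply: FD; exists Bot => // a [].
have Dgood psi : good psi -> D [set a | ~ sat psi (glue (f \o a) idfun)].
  by move=> g; apply: FD; exists psi => // a [].
have [l [h [phi0 phi0E]]] := support_ord phi (glue inr inl : W + N -> N + W).
have [k kP] := not_shattered (ren (glue inr inl : 'I_l + W -> W + 'I_l) phi0).
have phiE x : Phi x <-> sat (S := N') (ren (glue inr inl : 'I_l + W -> W + 'I_l) phi0)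
    (glue (i' \o x) (e \o h)).
  rewrite /Phi sat_ren.
  have -> : glue (i' \o x) e = glue e (i' \o x) \o (glue inr inl : W + N -> N + W).
    by apply: funext => -[].
  rewrite phi0E.
  have -> // : glue (i' \o x) (e \o h) \o (glue inr inl : 'I_l + W -> W + 'I_l) =
    glue (e \o h) (i' \o x).
  by apply: funext => -[].
have [m0] := carrier_inhabited M'.
have [s ms] := morley_exists (fun=> m0) (fun=> False) k DU DPhi Dgood.
apply: (kP (fun t => i' \o s t)) => J.
have [sJ mJ] := morley_exists (fun=> m0)
  (fun u => exists2 t : 'I_k, u = t & t \in J) k DU DPhi Dgood.
set chi := ren _ phi0 in phiE *.
pose rho (t : 'I_k) : formula L ('I_l + (nat * W + A)) :=
  ren (glue (fun w => inr (inl (val t, w))) inl) chi.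
have rhoE s0 b t : sat (S := N') (rho t) (glue b (i' \o params s0)) <->
    sat chi (glue (i' \o s0 t) b).
  rewrite sat_ren.
  have -> // : glue b (i' \o params s0) \o glue (fun w => inr (inl (val t, w))) inl =
    glue (i' \o s0 t) b.
  by apply: funext => -[].
pose xi := Exists (Conj [seq if t \in J then rho t else Not (rho t) | t <- enum 'I_k]).
have xiE s0 : sat xi (params s0) <->
    exists b : 'I_l -> N', forall t : 'I_k, sat chi (glue (i' \o s0 t) b) <-> t \in J.
  rewrite side_elementary sat_Exists.
  split=> -[b bP]; exists b.
    move=> t; move/sat_Conj : bP => /(_ _ (map_f _ (mem_enum _ t))).
    by rewrite -rhoE; case: (t \in J) => h1; split=> // /h1.
  apply: (sat_Conj _ _).2 => _ /mapP[t _ ->]; have := bP t; rewrite -rhoE.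
  by case: (t \in J) => -[h1 h2] //; [exact: h2|move=> /h1].
apply/xiE/(morley_type DU ms mJ)/xiE; exists (e \o h) => t; rewrite -phiE.
rewrite (morley_pattern mJ)//; split=> [[u /val_inj ->]//|tJ].
by exists t.
Qed.

End Honest.

(** * Quantifier elimination in the Shelah expansion *)

(** Externally definable sets may be given by parameters in M' instead of N, as
    the L-type over M of such parameters is realized in N. *)
Lemma realize_over_base l (c : 'I_l -> M') : exists d : 'I_l -> N,
  forall xi : formula L ('I_l + M), sat xi (glue c j) <-> sat xi (glue d i).
Proof.
have [|F Ffin Fc|d dP] := @N_sat _ i _ l [set xi | sat xi (glue c j)].
- exact: card_image_le.
- have /finite_seqP[s sE] : finite_set (F : set {classic (formula L ('I_l + M))}) by [].
  have [|d dP] := (elementary_exists id (Conj s) small_elementary).2.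
    by exists c; rewrite sat_Conj => xi xis; apply: Fc; rewrite sE.
  exists (i \o d) => // xi; rewrite sE => /= xis.
  rewrite /defset /= -[i in glue _ i]/(i \o id) -glue_comp; apply/i_elem.
  by move: dP; rewrite sat_Conj; apply.
exists d => xi; split; first exact: dP.
by move=> dxi; apply: contrapT => nc; exact: (dP (Not xi)).
Qed.

(** With psi an honest definition of phi(M, d), the projection of phi(M, d) is
    the trace on M of the projection of psi(M'): a witness in M' of psi is one
    of phi, so that there is also one in M by elementarity. Being a statement
    on M^Sh, this transfers to M'. *)
Lemma projection (W : finType) (phi : formula L ((unit + W) + N)) :
  exists phi2 : formula L (W + N), forall x : W -> M',
  (exists z : unit -> M', sat phi (glue (i' \o glue z x) e)) <->
  sat phi2 (glue (i' \o x) e).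
Proof.
have [psi psi1 psi2] := honest_definition small_base phi.
pose assoc (u : (unit + W) + M') : unit + (W + M') := match u with
  | inl (inl t) => inl t | inl (inr w) => inr (inl w) | inr m => inr (inr m) end.
pose theta := Exists (ren assoc psi).
have thetaE x : sat theta (glue x idfun) <->
    exists z, sat psi (glue (glue z x) idfun).
  rewrite sat_Exists; suff E z : sat (ren assoc psi) (glue z (glue x idfun)) <->
      sat psi (glue (glue z x) idfun) by split=> -[z /E]; exists z.
  rewrite sat_ren; have -> // : glue z (glue x idfun) \o assoc = glue (glue z x) idfun.
  by apply: funext => -[[]|].
have [l [h [theta0 theta0E]]] := support_ord theta (glue inr inl : W + M' -> M' + W).
have [d dP] := realize_over_base h.
pose phi2 := ren (glue (inr \o d) inl : 'I_l + W -> W + N) theta0.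
exists phi2.
have key (x : W -> M) : @sat _ MSh _ (named phi2) x <->
    exists z, @sat _ MSh _ (named phi) (glue z x).
  rewrite sat_named sat_ren.
  have -> : glue (i \o x) idfun \o (glue (inr \o d) inl : 'I_l + W -> W + N) =
      glue d i \o glue inl (inr \o x) by apply: funext => -[].
  rewrite -sat_ren -dP sat_ren.
  have -> : glue h j \o glue inl (inr \o x) = glue (idfun \o h) (j \o x).
    by apply: funext => -[].
  rewrite -theta0E.
  have -> : glue idfun (j \o x) \o (glue inr inl : W + M' -> M' + W) =
      glue (j \o x) idfun by apply: funext => -[].
  rewrite thetaE; split=> -[z].
    move=> /psi1 zphi.
    apply: (@elementary_exists _ MSh MSh' j _ _ x (named phi) shelah_elementary).2.
    by exists z; apply/sat_named.
  move=> /sat_named/big_elementary zphi.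
  exists (j \o z); rewrite -glue_comp; apply: psi2.
  move: zphi; rewrite glue_comp.
  have -> // : e \o (i \o glue z x) = i' \o (j \o glue z x).
  by apply: funext => u /=; rewrite j_comm.
move=> x; rewrite -sat_named.
have E (y : W -> M') : @sat _ MSh' _ (Iff (named phi2) (Exists (named phi))) y.
  move: y; apply: (elementary_valid shelah_elementary) => y.
  by rewrite sat_Iff key sat_Exists.
move: (E x); rewrite sat_Iff sat_Exists => ->.
by split=> -[z]; [move=> ?; exists z; apply/sat_named|move=> /sat_named; exists z].
Qed.

Lemma eval_side (V : Type) (t : term (shelah_lang L N) V) (v : V -> M') :
  eval (glue (i' \o v) e) (tren inl (tback t)) = i' (@eval _ MSh' V v t).
Proof.
rewrite eval_tren; have -> : glue (i' \o v) e \o inl = i' \o v by [].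
rewrite -eval_embedding//; congr i'.
exact: (@eval_tback L _ _ M' (fun s => @rinterp _ MSh' s)).
Qed.

Lemma quantifier_elimination (V : Type) (chi : formula (shelah_lang L N) V) :
  exists phi : formula L (V + N), forall v : V -> M',
  @sat _ MSh' _ chi v <-> sat phi (glue (i' \o v) e).
Proof.
elim: chi => {V} [V|V t u|V s ts|V chi1 [phi1 E1] chi2 [phi2 E2]|V chi [phi E]].
- by exists Bot.
- exists (Eq (tren inl (tback t)) (tren inl (tback u))) => v /=.
  by rewrite !eval_side; split=> [->//|]; exact: embedding_inj.
- case: s ts => [r|R] ts.
    exists (@Rel L _ r (fun k => tren inl (tback (ts k)))) => v /=.
    rewrite (embedding_rel i'_emb).
    have -> // : (fun k => eval (glue (i' \o v) e) (tren inl (tback (ts k)))) =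
      i' \o (fun k => @eval _ MSh' V v (ts k)).
    by apply: funext => k; exact: eval_side.
  exists (subst (projT2 R) (glue (fun k => tren inl (tback (ts k)))
    (fun d => Var L (inr d)))) => v /=.
  rewrite sat_subst.
  have -> // : (fun x => eval (glue (i' \o v) e) (glue (fun k => tren inl (tback (ts k)))
      (fun d => Var L (inr d)) x)) = glue (i' \o (fun k => @eval _ MSh' V v (ts k))) e.
  by apply: funext => -[k|d] //=; exact: eval_side.
- by exists (Imp phi1 phi2) => v /=; rewrite E1 E2.
- pose g (u : option V + N) : V + option N := match u with
    | inl (Some x) => inl x | inl None => inr None | inr d => inr (Some d) end.
  have [W [h [phi1 phi1E]]] := support phi g.
  pose r (u : W + option N) : (unit + W) + N := match u with
    | inl w => inl (inr w) | inr None => inl (inl tt) | inr (Some d) => inr d end.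
  have [phi2 phi2E] := projection (ren r (Not phi1)).
  exists (Not (ren (glue (inl \o h) inr) phi2)) => v.
  rewrite sat_Not sat_ren.
  have -> : glue (i' \o v) e \o glue (inl \o h) inr = glue (i' \o (v \o h)) e.
    by apply: funext => -[].
  rewrite -phi2E.
  have key z : sat (ren r (Not phi1)) (glue (i' \o glue z (v \o h)) e) <->
      ~ @sat _ MSh' _ chi (fun o => if o is Some x then v x else z tt).
    rewrite E sat_ren sat_Not.
    pose b (o : option N) := if o is Some d then e d else i' (z tt).
    have -> : glue (i' \o glue z (v \o h)) e \o r = glue ((i' \o v) \o h) b.
      by apply: funext => -[|[]].
    rewrite -phi1E.
    have -> // : glue (i' \o v) b \o g =
      glue (i' \o (fun o : option V => if o is Some x then v x else z tt)) e.
    by apply: funext => -[[]|].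
  split=> [h1 [z /key]|h1 a].
    by apply; exact: h1.
  by apply: contrapT => na; apply: h1; exists (fun=> a); apply/key.
Qed.

Lemma honest_shelah (W : finType) (A : Type) (f : A -> M')
    (chi : formula (shelah_lang L N) (W + M)) : small (range f) ->
  exists2 psi : formula L (W + M'),
  forall x, sat psi (glue x idfun) -> @sat _ MSh' _ chi (glue x j) &
  forall a, @sat _ MSh' _ chi (glue (f \o a) j) -> sat psi (glue (f \o a) idfun).
Proof.
move=> f_small; have [phi0 phi0E] := quantifier_elimination chi.
pose r (u : (W + M) + N) : W + N := match u with
  | inl (inl w) => inl w | inl (inr m) => inr (i m) | inr d => inr d end.
have E x : @sat _ MSh' _ chi (glue x j) <-> sat (ren r phi0) (glue (i' \o x) e).
  rewrite phi0E sat_ren.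
  have -> // : glue (i' \o x) e \o r = glue (i' \o glue x j) e.
  by apply: funext => -[[w|m]|d] //=; rewrite j_comm.
have [psi psi1 psi2] := honest_definition f_small (ren r phi0).
by exists psi => [x /psi1/E|a /E/psi2].
Qed.

(** * fsg subgroups *)

Variables (n : nat) (gamma : formula L ('I_n + M))
  (mu : formula L ('I_n + 'I_n + 'I_n + M)).
Hypothesis G_group : is_group (defset M idfun gamma) (defmul M idfun mu).

Let G := defset M' j gamma.
Let mul := defmul M' j mu.

Definition coords (k : nat) (S : Type) (x : 'I_k -> 'I_n -> S) (u : 'I_k * 'I_n) : S :=
  x u.1 u.2.

Section Transfer.
Variable k : nat.

(* The t-th of k tuples of variables. *)
Let tup (t : 'I_k) (u : 'I_n) : 'I_k * 'I_n + M := inl (t, u).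

Definition member (t : 'I_k) : formula L ('I_k * 'I_n + M) :=
  ren (glue (tup t) inr) gamma.

Definition product (r s t : 'I_k) : formula L ('I_k * 'I_n + M) :=
  ren (glue (triple (tup r) (tup s) (tup t)) inr) mu.

Definition equal (s t : 'I_k) : formula L ('I_k * 'I_n + M) :=
  Conj [seq Eq (Var L (tup s u)) (Var L (tup t u)) | u <- enum 'I_n].

Variables (S : structure L) (c : M -> S) (x : 'I_k -> 'I_n -> S).
Let w := glue (coords x) c.

Lemma sat_member t : sat (member t) w <-> defset S c gamma (x t).
Proof.
rewrite sat_ren /defset /=.
by have -> // : w \o glue (tup t) inr = glue (x t) c by apply: funext => -[].
Qed.

Lemma sat_product r s t : sat (product r s t) w <-> defmul S c mu (x r) (x s) (x t).
Proof.
rewrite sat_ren /defmul /defset /=.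
have -> // : w \o glue (triple (tup r) (tup s) (tup t)) inr =
  glue (triple (x r) (x s) (x t)) c.
by apply: funext => -[[[]|]|].
Qed.

Lemma sat_equal s t : sat (equal s t) w <-> x s = x t.
Proof.
rewrite sat_Conj; split=> [h|h _ /mapP[u _ ->]].
  by apply: funext => u; exact: (h _ (map_f _ (mem_enum _ u))).
exact: (congr1 (fun f => f u) h).
Qed.

End Transfer.

Lemma transfer_tuples k (chi : formula L ('I_k * 'I_n + M)) :
  (forall x : 'I_k -> 'I_n -> M, sat chi (glue (coords x) idfun)) ->
  forall x : 'I_k -> 'I_n -> M', sat chi (glue (coords x) j).
Proof.
move=> chiM x; move: (coords x); apply: (elementary_forall _ _ small_elementary).1 => y.
have := chiM (fun a b => y (a, b)).
by have -> : coords (fun a b => y (a, b)) = y by apply: funext => -[].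
Qed.

Lemma group_unique (X : Type) (H : set X) m x y z z' : is_group H m ->
  H x -> H y -> H z -> H z' -> m x y z -> m x y z' -> z = z'.
Proof.
move=> [tot _ _] Hx Hy Hz Hz' mz mz'.
by have [u [_ uu]] := tot _ _ Hx Hy; rewrite -(uu z)// -(uu z').
Qed.

(** The group law [g = (g h) h^-1] as a universal sentence about [G], which
    transfers from M to M'. The inverse [h'] is meant in a subgroup, whose
    identity [d] is only known to be idempotent. *)
Lemma group_cancel (X : Type) (H : set X) m d g h h' gh k : is_group H m ->
  H d -> H g -> H h -> H h' -> H gh -> H k ->
  m d d d -> m h h' d -> m g h gh -> m gh h' k -> k = g.
Proof.
move=> mG Hd Hg Hh Hh' Hgh Hk ddd hh' ghE kE; have [tot assoc [e1 He1 e1P]] := mG.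
have [_ ge1 _] := e1P _ Hg.
have [e1d _ [d' Hd' [_ d'd]]] := e1P _ Hd.
have de1 : d = e1.
  apply: (group_unique mG Hd' Hd) => //.
  exact: (assoc _ _ _ _ _ _ Hd' Hd Hd He1 Hd Hd d'd ddd e1d).
apply: (group_unique mG Hg Hd) => //; last by rewrite de1.
exact: (assoc _ _ _ _ _ _ Hg Hh Hh' Hgh Hd Hk ghE hh' kE).
Qed.

Lemma mul_unique x y z z' : G x -> G y -> G z -> G z' ->
  mul x y z -> mul x y z' -> z = z'.
Proof.
move=> Gx Gy Gz Gz' mz mz'.
pose o a (ak : (a < 4)%N) : 'I_4 := Ordinal ak.
pose chi := (Imp (member (o 0 isT)) (Imp (member (o 1 isT))
  (Imp (member (o 2 isT)) (Imp (member (o 3 isT))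
  (Imp (product (o 0 isT) (o 1 isT) (o 2 isT))
  (Imp (product (o 0 isT) (o 1 isT) (o 3 isT))
       (equal (o 2 isT) (o 3 isT)))))))).
have chiM v : sat chi (glue (coords v) idfun).
  rewrite /chi !sat_Imp !sat_member !sat_product sat_equal.
  exact: group_unique.
have := transfer_tuples chiM (fun t => nth x [:: x; y; z; z'] t).
by rewrite /chi !sat_Imp !sat_member !sat_product sat_equal; apply.
Qed.

Lemma mul_cancel d g h h' gh k :
  G d -> G g -> G h -> G h' -> G gh -> G k ->
  mul d d d -> mul h h' d -> mul g h gh -> mul gh h' k -> k = g.
Proof.
move=> Gd Gg Gh Gh' Ggh Gk m1 m2 m3 m4.
pose o a (ak : (a < 6)%N) : 'I_6 := Ordinal ak.
pose chi := (Imp (member (o 0 isT)) (Imp (member (o 1 isT))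
  (Imp (member (o 2 isT)) (Imp (member (o 3 isT))
  (Imp (member (o 4 isT)) (Imp (member (o 5 isT))
  (Imp (product (o 0 isT) (o 0 isT) (o 0 isT))
  (Imp (product (o 2 isT) (o 3 isT) (o 0 isT))
  (Imp (product (o 1 isT) (o 2 isT) (o 4 isT))
  (Imp (product (o 4 isT) (o 3 isT) (o 5 isT))
       (equal (o 5 isT) (o 1 isT)))))))))))).
have chiM v : sat chi (glue (coords v) idfun).
  rewrite /chi !sat_Imp !sat_member !sat_product sat_equal.
  exact: group_cancel.
have := transfer_tuples chiM (fun t => nth d [:: d; g; h; h'; gh; k] t).
by rewrite /chi !sat_Imp !sat_member !sat_product sat_equal; apply.
Qed.

Section Subgroup.
Variable H : set ('I_n -> M').
Hypotheses (HG : H `<=` G) (H_group : is_group H mul).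

Lemma subgroup_cancel g h gh : G g -> H h -> H gh -> mul g h gh -> H g.
Proof.
move=> Gg Hh Hgh ghE; have [tot _ [d Hd dP]] := H_group.
have [ddd _ _] := dP _ Hd; have [_ _ [h' Hh' [hh' _]]] := dP _ Hh.
have [k [[Hk kE] _]] := tot _ _ Hgh Hh'.
have <- // : k = g.
by apply: (@mul_cancel d g h h' gh) => //; exact: HG.
Qed.

(** If all points of H(M0) satisfy psi then so do all translates g p of the
    fsg type p, being finitely satisfiable in H(M0). Hence p contains the
    formula psi(g x), which then has a realization in H(M0). *)
Lemma fsg_translates : fsg K MSh' H mul ->
  exists (A : Type) (f : A -> M'), small (range f) /\
  forall psi : formula (shelah_lang L N) ('I_n + M'),
    (forall a, H (f \o a) -> @sat _ MSh' _ psi (glue (f \o a) idfun)) ->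
    forall g, H g -> exists a h,
      [/\ H (f \o a), H h, mul g (f \o a) h & @sat _ MSh' _ psi (glue h idfun)].
Proof.
move=> [p [M0 [f [[[_ p_complete] _] _ M0K _ p_fs]]]].
exists M0, f; split; first exact: small_range.
move=> psi psiM0 g Hg.
have [tot _ [d Hd dP]] := H_group.
(* alpha(x) is psi(g x) *)
pose alpha : formula (shelah_lang L N) ('I_n + M') := Forall
  (Imp (incl N (ren (glue inl (inr \o inr \o j)) gamma))
  (Imp (incl N (ren (glue (triple (inr \o inr \o g) (inr \o inl) inl)
                 (inr \o inr \o j)) mu))
       (ren (glue inl (inr \o inr)) psi))).
have alphaE x : @sat _ MSh' _ alpha (glue x idfun) <->
    forall z, G z -> mul g x z -> @sat _ MSh' _ psi (glue z idfun).
  rewrite sat_Forall; suff E z : @sat _ MSh' _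
     (Imp (incl N (ren (glue inl (inr \o inr \o j)) gamma))
     (Imp (incl N (ren (glue (triple (inr \o inr \o g) (inr \o inl) inl)
                 (inr \o inr \o j)) mu))
       (ren (glue inl (inr \o inr)) psi))) (glue z (glue x idfun)) <->
      (G z -> mul g x z -> @sat _ MSh' _ psi (glue z idfun)).
    by split=> h z; [apply/E|apply/E]; exact: h.
  rewrite !sat_Imp !sat_incl !sat_ren.
  have -> : glue z (glue x idfun) \o glue inl (inr \o inr \o j) = glue z j.
    by apply: funext => -[].
  have -> : glue z (glue x idfun) \o glue (triple (inr \o inr \o g) (inr \o inl) inl)
                 (inr \o inr \o j) = glue (triple g x z) j.
    by apply: funext => -[[[]|]|].
  have -> // : glue z (glue x idfun) \o glue inl (inr \o inr) = glue z idfun.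
  by apply: funext => -[].
have alphaH x h : H x -> H h -> mul g x h ->
    (@sat _ MSh' _ alpha (glue x idfun) <-> @sat _ MSh' _ psi (glue h idfun)).
  move=> Hx Hh gxh; rewrite alphaE; split=> [|s z Gz gxz]; first by apply=> //; exact: HG.
  by rewrite -(@mul_unique g x h z)//; exact: HG.
have realized g0 (phi : formula (shelah_lang L N) ('I_n + M')) : H g0 ->
    @translate _ MSh' _ H mul g0 p phi ->
    exists2 a, H (f \o a) & @sat _ MSh' _ phi (glue (f \o a) idfun).
  move=> Hg0 g0phi.
  have [|x [Hx [a xE]] xphi] := p_fs g0 Hg0 [set phi] (finite_set1 _).
    by move=> _ ->.
  by exists a; rewrite -xE//; exact: xphi.
have [palpha|pnalpha] := p_complete alpha.
  have [|a Ha aalpha] := realized d alpha Hd.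
    exists alpha => // x dx Hx Hdx dxE; have [dxx _ _] := dP _ Hx.
    by rewrite (@mul_unique d x dx x)//; exact: HG.
  have [h [[Hh gah] _]] := tot _ _ Hg Ha.
  by exists a, h; split=> //; apply/(alphaH (f \o a)).
have [|a Ha] := realized g (Not psi) Hg.
  exists (Not alpha) => // x gx Hx Hgx gxE.
  by rewrite /defset /= (alphaH _ _ Hx Hgx gxE).
by rewrite sat_Not => na; case: na; exact: psiM0.
Qed.


Hypothesis H_tdef : type_definable MSh' j H.

(** H is the intersection of these sets, which unlike the members of a given
    partial type are closed under conjunction. *)
Let over (chi : formula (shelah_lang L N) ('I_n + M)) := H `<=` defset MSh' j chi.

Lemma overP x : (forall chi, over chi -> defset MSh' j chi x) -> H x.
Proof.
have [pi piE] := H_tdef; rewrite piE => h chi pichi; apply: h => y.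
by rewrite piE; exact.
Qed.

Lemma over_Conj (s : seq {classic (formula (shelah_lang L N) ('I_n + M))}) :
  (forall chi, chi \in s -> over chi) -> over (Conj s).
Proof. by move=> os x Hx; apply/sat_Conj => chi /os; exact. Qed.

(** Otherwise compactness gives g in G outside chi0 and h, g h in H; but these
    conditions imply that g is in H. *)
Lemma over_cancel chi0 : over chi0 -> exists2 chi, over chi &
  forall g h gh, G g -> defset MSh' j chi h -> defset MSh' j chi gh ->
    mul g h gh -> defset MSh' j chi0 g.
Proof.
move=> Hchi0; apply: contrapT => nchi.
pose I := {chi | over chi}.
pose at_ (r : 'I_n -> 'I_n + 'I_n + 'I_n) (chi : formula (shelah_lang L N) ('I_n + M)) :=
  ren (glue (inl \o r) inr) chi.
pose X (t : I) := And (And (at_ (inl \o inl) (incl N gamma)) (incl N mu))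
  (And (Not (at_ (inl \o inl) chi0)) (And (at_ (inl \o inr) (sval t)) (at_ inr (sval t)))).
have atE r chi (w : 'I_n + 'I_n + 'I_n -> M') :
    @sat _ MSh' _ (at_ r chi) (glue w j) <-> defset MSh' j chi (w \o r).
  rewrite sat_ren; have -> // : glue w j \o glue (inl \o r) inr = glue (w \o r) j.
  by apply: funext => -[].
have XE t g h gh : @sat _ MSh' _ (X t) (glue (triple g h gh) j) <->
    [/\ G g, mul g h gh, ~ defset MSh' j chi0 g, defset MSh' j (sval t) h &
        defset MSh' j (sval t) gh].
  rewrite /X !sat_And sat_Not !atE /defset /= !sat_incl.
  by split=> [[[? ?] [? [? ?]]]|[]]; do ?split.
have [s|w wX] := compactness (X := X) small_base.
  apply: contrapT => nw; apply: nchi; exists (Conj [seq sval t | t : {classic I} <- s]).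
    by apply: over_Conj => _ /mapP[t _ ->]; exact: svalP.
  move=> g h gh Gg /sat_Conj sh /sat_Conj sgh ghE; apply: contrapT => ng.
  apply: nw; exists (triple g h gh) => t ts; apply/XE; split=> //.
    by apply: sh; apply/mapP; exists t.
  by apply: sgh; apply/mapP; exists t.
pose g u := w (inl (inl u)); pose h u := w (inl (inr u)); pose gh u := w (inr u).
have wE : w = triple g h gh by apply: funext => -[[]|].
rewrite wE in wX; have {}wX t := (XE t g h gh).1 (wX t).
have [Gg ghE ng _ _] := wX (exist _ chi0 Hchi0).
apply: ng; apply: Hchi0; apply: (@subgroup_cancel g h gh) => //.
  by apply: overP => chi Hchi; have [] := wX (exist _ chi Hchi).
by apply: overP => chi Hchi; have [] := wX (exist _ chi Hchi).
Qed.

Section Translates.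
Variables (A : Type) (f : A -> M').
Hypothesis f_small : small (range f).
(* The conclusion of fsg_translates, with A the universe of M0. *)
Hypothesis translates : forall psi : formula (shelah_lang L N) ('I_n + M'),
  (forall a, H (f \o a) -> @sat _ MSh' _ psi (glue (f \o a) idfun)) ->
  forall g, H g -> exists a h,
    [/\ H (f \o a), H h, mul g (f \o a) h & @sat _ MSh' _ psi (glue h idfun)].

(** No g in H and b have H(M0) contained in phi(x, b) while g H(M0) avoids
    phi(x, b). Thus a type in the variables (g, b) over M and M0 is
    inconsistent, and so is a finite part of it. As b is a variable here, the
    finite part depends on phi only. *)
Lemma uniform_translates l (phi : formula L ('I_n + 'I_l)) :
  exists k (a : 'I_k -> 'I_n -> A), (forall t, H (f \o a t)) /\
  exists2 chi, over chi & forall g b, G g -> defset MSh' j chi g ->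
    (forall t, sat phi (glue (f \o a t) b)) ->
    exists t h, [/\ G h, mul g (f \o a t) h & sat phi (glue h b)].
Proof.
apply: contrapT => nka.
pose I := ({chi | over chi} + {a | H (f \o a)})%type.
pose pa (a : 'I_n -> A) u : 'I_n + 'I_l + (M + A) := inr (inr (a u)).
pose pm (m : M) : 'I_n + 'I_l + (M + A) := inr (inl m).
(* g a is not in phi(x, b), for (g, b) the free variables *)
pose avoid a : formula L ('I_n + 'I_l + (M + A)) := Forall (Imp
  (ren (glue inl (inr \o pm)) gamma) (Imp
  (ren (glue (triple (inr \o inl \o inl) (inr \o pa a) inl) (inr \o pm)) mu)
  (Not (ren (glue inl (inr \o inl \o inr)) phi)))).
pose X (t : I) : formula (shelah_lang L N) ('I_n + 'I_l + (M + A)) := match t with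
  | inl chi => ren (glue (inl \o inl) pm) (sval chi)
  | inr a => incl N (And (ren (glue (pa (sval a)) (inl \o inr)) phi) (avoid (sval a)))
  end.
pose c := glue j f.
have X1 chi g b : @sat _ MSh' _ (X (inl chi)) (glue (glue g b) c) <->
    defset MSh' j (sval chi) g.
  rewrite sat_ren.
  have -> // : glue (glue g b) c \o glue (inl \o inl) pm = glue g j.
  by apply: funext => -[].
have X2 a g b : @sat _ MSh' _ (X (inr a)) (glue (glue g b) c) <->
    sat phi (glue (f \o sval a) b) /\
    ~ exists h, [/\ G h, mul g (f \o sval a) h & sat phi (glue h b)].
  rewrite sat_incl sat_And sat_ren.
  have -> : glue (glue g b) c \o glue (pa (sval a)) (inl \o inr) =
    glue (f \o sval a) b by apply: funext => -[].
  suff -> : sat (avoid (sval a)) (glue (glue g b) c) <->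
    ~ exists h, [/\ G h, mul g (f \o sval a) h & sat phi (glue h b)] by [].
  have E1 h : sat (ren (glue inl (inr \o pm)) gamma) (glue h (glue (glue g b) c)) <-> G h.
    rewrite sat_ren.
    have -> // : glue h (glue (glue g b) c) \o glue inl (inr \o pm) = glue h j.
    by apply: funext => -[].
  have E2 h : sat (ren (glue (triple (inr \o inl \o inl) (inr \o pa (sval a)) inl)
      (inr \o pm)) mu) (glue h (glue (glue g b) c)) <-> mul g (f \o sval a) h.
    rewrite sat_ren; have -> // : glue h (glue (glue g b) c) \o
        glue (triple (inr \o inl \o inl) (inr \o pa (sval a)) inl) (inr \o pm) =
        glue (triple g (f \o sval a) h) j.
    by apply: funext => -[[[]|]|].
  have E3 h : sat (ren (glue inl (inr \o inl \o inr)) phi) (glue h (glue (glue g b) c)) <->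
      sat phi (glue h b).
    rewrite sat_ren.
    have -> // : glue h (glue (glue g b) c) \o glue inl (inr \o inl \o inr) =
      glue h b.
    by apply: funext => -[].
  rewrite sat_Forall; split=> [h [y [/E1 y1 /E2 y2 /E3 y3]]|h y].
    by have := h y; rewrite !sat_Imp; apply.
  by rewrite !sat_Imp => /E1 y1 /E2 y2 /E3 y3; apply: h; exists y.
have c_small : small (range c).
  apply: (@small_sub _ (range j `|` range f)); last by apply: smallU => //; exact: small_base.
  by move=> _ [[m|a] _ <-]; [left; exists m|right; exists a].
have [s|w wX] := compactness (X := X) c_small.
  apply: contrapT => nw; apply: nka.
  pose s1 : seq {classic {chi | over chi}} :=
    pmap (fun t : {classic I} => if t is inl u then Some u else None) s.
  pose s2 : seq {classic {a | H (f \o a)}} :=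
    pmap (fun t : {classic I} => if t is inr u then Some u else None) s.
  exists (size s2), (fun t => sval (tnth (in_tuple s2) t)); split.
    by move=> t; exact: (svalP (tnth (in_tuple s2) t)).
  exists (Conj [seq sval u | u : {classic _} <- s1]).
    by apply: over_Conj => _ /mapP[t _ ->]; exact: svalP.
  move=> g b Gg sg phiE; apply: contrapT => nt; apply: nw; exists (glue g b).
  move=> [u|u] us.
    apply/X1; move/sat_Conj : sg; apply; apply/mapP; exists u => //.
    by rewrite mem_pmap; apply/mapP; exists (inl u).
  have us2 : (u : {classic {a | H (f \o a)}}) \in s2.
    by rewrite mem_pmap; apply/mapP; exists (inr u).
  have [t ->] : exists t, u = tnth (in_tuple s2) t.
    by move: us2; rewrite -[s2]/(tval (in_tuple s2)) => /tnthP[t]; exists t.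
  apply/X2; split; first exact: phiE.
  by move=> [h hP]; apply: nt; exists t, h.
pose g u := w (inl u); pose b u := w (inr u).
have wE : w = glue g b by apply: funext => -[].
rewrite wE in wX.
have Hg : H g by apply: overP => chi Hchi; exact: (X1 (exist _ chi Hchi) g b).1.
have phib a : H (f \o a) -> sat phi (glue (f \o a) b).
  by move=> Ha; have [] := (X2 (exist _ a Ha) g b).1 (wX _).
pose psi := incl N (ren (glue inl (inr \o b)) phi).
have psiE x : @sat _ MSh' _ psi (glue x idfun) <-> sat phi (glue x b).
  rewrite sat_incl sat_ren.
  have -> // : glue x idfun \o glue inl (inr \o b) = glue x b by apply: funext => -[].
have [|a [h [Ha Hh gah /psiE hb]]] := translates _ Hg (psi := psi).
  by move=> a Ha; apply/psiE; exact: phib.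
have [_ []] := (X2 (exist _ a Ha) g b).1 (wX _).
by exists h; split=> //; exact: HG.
Qed.

Lemma separate_params (psi : formula L ('I_n + M')) :
  exists l (c : 'I_l -> M') (phi : formula L ('I_n + 'I_l)),
  forall x : 'I_n -> M', sat psi (glue x idfun) <-> sat phi (glue x c).
Proof.
have [l [c [phi phiE]]] := support_ord psi (glue inr inl : 'I_n + M' -> M' + 'I_n).
exists l, c, (ren (glue inr inl) phi) => x; rewrite sat_ren.
have -> : glue x c \o glue inr inl = glue (idfun \o c) x by apply: funext => -[].
rewrite -phiE.
by have -> : glue idfun x \o glue inr inl = glue x idfun by apply: funext => -[].
Qed.

(** For an honest definition psi = phi(x, c) of chi over M0, the set theta0 of
    all g in G such that g m is in psi for one of finitely many m in H(M0) lies
    between a set chi1 containing H and chi0. That suitable parameters exist is expressed in the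
    expanded language over M, and so there are some in M. *)
Lemma definable_interpolant chi0 : over chi0 -> exists2 theta : formula L ('I_n + M),
  H `<=` defset M' j theta & defset M' j theta `<=` defset MSh' j chi0.
Proof.
move=> Hchi0; have [chi Hchi cancel] := over_cancel Hchi0.
have [psi psi1 psi2] := honest_shelah chi f_small.
have [l [c [phi phiE]]] := separate_params psi.
have [k [a [Ha [chi1 Hchi1 chi1P]]]] := uniform_translates phi.
pose W := ('I_k * 'I_n + 'I_l)%type.
pose P := ('I_n + ('I_n + (W + M)))%type.
pose pw (w : W) : P := inr (inr (inl w)).
pose pm (m : M) : P := inr (inr (inr m)).
pose body t : formula L P := And (ren (glue inl pm) gamma) (And
  (ren (glue (triple (inr \o inl) (fun u => pw (inl (t, u))) inl) pm) mu)
  (ren (glue inl (pw \o inr)) phi)).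
pose theta0 := And (ren (glue inl (inr \o inr)) gamma)
  (Not (Conj [seq Not (Exists (body t)) | t <- enum 'I_k])).
have theta0E g w : sat theta0 (glue g (glue w j)) <-> G g /\ exists t h,
    [/\ G h, mul g (fun u => w (inl (t, u))) h & sat phi (glue h (w \o inr))].
  have bodyE t h : sat (body t) (glue h (glue g (glue w j))) <->
      [/\ G h, mul g (fun u => w (inl (t, u))) h & sat phi (glue h (w \o inr))].
    rewrite !sat_And !sat_ren.
    have -> : glue h (glue g (glue w j)) \o glue inl pm = glue h j.
      by apply: funext => -[].
    have -> : glue h (glue g (glue w j)) \o
        glue (triple (inr \o inl) (fun u => pw (inl (t, u))) inl) pm =
        glue (triple g (fun u => w (inl (t, u))) h) j.
      by apply: funext => -[[[]|]|].
    have -> : glue h (glue g (glue w j)) \o glue inl (pw \o inr) = glue h (w \o inr).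
      by apply: funext => -[].
    by split=> [[? []]|[]].
  rewrite sat_And sat_ren sat_Not.
  have -> : glue g (glue w j) \o glue inl (inr \o inr) = glue g j.
    by apply: funext => -[].
  suff -> : ~ sat (Conj [seq Not (Exists (body t)) | t <- enum 'I_k]) (glue g (glue w j)) <->
    exists t h, [/\ G h, mul g (fun u => w (inl (t, u))) h &
                    sat phi (glue h (w \o inr))] by [].
  rewrite sat_Conj; split=> [nall|[t [h /bodyE hP]] all].
    apply: contrapT => nt; apply: nall => _ /mapP[t _ ->].
    by rewrite sat_Not sat_Exists => -[h /bodyE hP]; apply: nt; exists t, h.
  have := all _ (map_f _ (mem_enum _ t)).
  by rewrite sat_Not sat_Exists; apply; exists h.
pose lift_ chi' : formula (shelah_lang L N) ('I_n + (W + M)) :=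
  ren (glue inl (inr \o inr)) chi'.
pose between := Forall (And
  (Imp (lift_ (incl N gamma)) (Imp (lift_ chi1) (incl N theta0)))
  (Imp (incl N theta0) (lift_ chi0))).
have betweenE w : @sat _ MSh' _ between (glue w j) <-> forall g,
    (G g -> defset MSh' j chi1 g -> sat theta0 (glue g (glue w j))) /\
    (sat theta0 (glue g (glue w j)) -> defset MSh' j chi0 g).
  have lE chi' g : @sat _ MSh' _ (lift_ chi') (glue g (glue w j)) <-> defset MSh' j chi' g.
    rewrite sat_ren; have -> // : glue g (glue w j) \o glue inl (inr \o inr) = glue g j.
    by apply: funext => -[].
  have E g : @sat _ MSh' _ (And
      (Imp (lift_ (incl N gamma)) (Imp (lift_ chi1) (incl N theta0)))
      (Imp (incl N theta0) (lift_ chi0))) (glue g (glue w j)) <->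
      (G g -> defset MSh' j chi1 g -> sat theta0 (glue g (glue w j))) /\
      (sat theta0 (glue g (glue w j)) -> defset MSh' j chi0 g).
    by rewrite sat_And !sat_Imp !lE !sat_incl /defset /= sat_incl.
  by rewrite sat_Forall; split=> h g; [apply/E|apply/E]; exact: h.
have [w wP] : exists w : W -> M, @sat _ MSh _ between (glue w idfun).
  apply: (@elementary_exists _ MSh MSh' j W _ idfun between shelah_elementary).2.
  exists (glue (fun u => f (a u.1 u.2)) c); apply/betweenE => g; split.
    move=> Gg chi1g; apply/theta0E; split=> //.
    apply: chi1P => // t; rewrite -phiE; apply: psi2.
    by have := Hchi _ (Ha t).
  move=> /theta0E[Gg [t [h [Gh gah /phiE/psi1 hchi]]]].
  exact: (cancel _ _ _ Gg (Hchi _ (Ha t)) hchi gah).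
move/shelah_elementary : wP; rewrite glue_comp => /betweenE wP.
pose theta := ren (glue inl (inr \o glue w idfun)) theta0.
have thetaE g : defset M' j theta g <-> sat theta0 (glue g (glue (j \o w) j)).
  apply: (iff_trans (sat_ren _ _ _)).
  have -> // : glue g j \o glue inl (inr \o glue w idfun) = glue g (glue (j \o w) j).
  by apply: funext => -[|[]].
exists theta => g; first by move=> Hg; apply/thetaE/(wP g).1; [exact: HG|exact: Hchi1].
by move=> /thetaE/(wP g).2.
Qed.

(** Formulas over [nat] serve as a common type for the phi(x, y) with [y] of any
    length: variables below [n] are those of [x]. *)
Definition split_nat (u : nat) : nat + 'I_n :=
  if insub u is Some t then inr t else inl (u - n)%N.

(** For g in the intersection and chi0 containing H, take chi from
    [over_cancel] and an honest definition psi = phi(x, b) of it over M0. The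
    formula chosen for phi yields m in H and h in psi with h = g m, and thus g
    is in chi0. *)
Lemma type_definable_small : exists2 Sigma : set (formula L ('I_n + M)),
  Sigma #<= [set: formula L nat] & H = tdefset M' j Sigma.
Proof.
have /choice[theta thetaP] (phi : formula L nat) :
    exists theta : formula L ('I_n + M), H `<=` defset M' j theta /\
    forall g, G g -> defset M' j theta g -> forall b : nat -> M',
      (forall a, H (f \o a) -> sat phi (glue b (f \o a) \o split_nat)) ->
      exists m h, [/\ H m, G h, mul g m h & sat phi (glue b h \o split_nat)].
  have [l [y [phi0 phi0E]]] := support_ord phi split_nat.
  have [k [a [Ha [chi Hchi chiP]]]] :=
    uniform_translates (ren (glue inr inl : 'I_l + 'I_n -> 'I_n + 'I_l) phi0).
  have [theta Htheta thetachi] := definable_interpolant Hchi.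
  exists theta; split=> // g Gg /thetachi/(chiP _ (_ \o y)) chig b bP.
  have E x : sat (ren (glue inr inl : 'I_l + 'I_n -> 'I_n + 'I_l) phi0)
      (glue x (b \o y)) <-> sat phi (glue b x \o split_nat).
    rewrite phi0E sat_ren.
    by have -> : glue x (b \o y) \o glue inr inl = glue (b \o y) x
      by apply: funext => -[].
  have [|t [h [Gh gah /E hE]]] := chig b Gg.
    by move=> t; apply/E; exact: bP.
  by exists (f \o a t), h.
have AndE phi g : defset M' j (And gamma (theta phi)) g <->
    G g /\ defset M' j (theta phi) g by exact: sat_And.
exists (range (fun phi => And gamma (theta phi))); first exact: card_image_le.
apply/seteqP; split=> g.
  by move=> Hg _ [phi _ <-]; apply/AndE; split; [exact: HG|exact: (thetaP phi).1].
move=> gP; apply: overP => chi0 Hchi0.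
have {}gP phi : G g /\ defset M' j (theta phi) g.
  by apply/AndE; apply: gP; exists phi.
have [chi Hchi cancel] := over_cancel Hchi0.
have [psi psi1 psi2] := honest_shelah chi f_small.
have [l [c [phi phiE]]] := separate_params psi.
have [m0] := carrier_inhabited M'.
pose b u := if insub u is Some t then c t else m0.
pose phi' := ren (glue val (fun t => n + val t)%N) phi : formula L nat.
have phi'E x : sat phi' (glue b x \o split_nat) <-> sat psi (glue x idfun).
  rewrite phiE sat_ren.
  have -> // : (glue b x \o split_nat) \o glue val (fun t => n + val t)%N = glue x c.
  apply: funext => -[t|t] /=; rewrite /split_nat.
    by rewrite valK.
  by rewrite insubF ?ltnNge ?leq_addr//= addKn /b valK.
have [Gg gtheta] := gP phi'.
have [|m [h [Hm Gh gmh /phi'E/psi1 hchi]]] := (thetaP phi').2 g Gg gtheta b.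
  by move=> a Ha; apply/phi'E/psi2; exact: (Hchi _ Ha).
exact: (cancel _ _ _ Gg (Hchi _ Hm) hchi gmh).
Qed.

End Translates.
End Subgroup.

Lemma fsg_type_definable (H : set ('I_n -> M')) :
  H `<=` G -> is_group H mul -> type_definable MSh' j H -> fsg K MSh' H mul ->
  exists2 Sigma : set (formula L ('I_n + M)),
    Sigma #<= [set: formula L nat] & H = tdefset M' j Sigma.
Proof.
move=> HG H_group H_tdef /(fsg_translates HG H_group)[A [f [f_small translates]]].
exact: type_definable_small translates.
Qed.

(** The same formula theta defines the set in M' and in M, as the equivalence
    of theta and chi is a statement over M. *)
Lemma fsg_definable (chi : formula (shelah_lang L N) ('I_n + M)) :
  defset MSh idfun chi `<=` defset M idfun gamma ->
  fsg K MSh' (defset MSh' j chi) mul -> definable M idfun (defset MSh idfun chi).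
Proof.
move=> chiG Hfsg; set H := defset MSh' j chi in Hfsg *.
have HG : H `<=` G.
  move=> x Hx; apply/(sat_incl i' e).
  have : @sat _ MSh' _ (Imp chi (incl N gamma)) (glue x (j \o idfun)); last by apply.
  apply: (elementary_forall _ _ shelah_elementary).1 => y chiy.
  by apply: (sat_incl i idfun gamma _).2; exact: (chiG y).
have H_group : is_group H mul by case: Hfsg => [p [M0 [f [_ _ _ []]]]].
have H_tdef : type_definable MSh' j H.
  exists [set chi]; apply/seteqP; split=> [x Hx _ ->//|x]; exact.
have [Sigma _ HE] := fsg_type_definable HG H_group H_tdef Hfsg.
pose I := {theta : formula L ('I_n + M) | H `<=` defset M' j theta}.
pose X (t : I) := And (incl N (sval t)) (Not chi).
have XE t x : @sat _ MSh' _ (X t) (glue x j) <->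
    defset M' j (sval t) x /\ ~ H x by rewrite sat_And sat_incl.
have [s sP] : exists s : seq {classic I}, forall x,
    (forall t, t \in s -> defset M' j (sval t) x) -> H x.
  apply: contrapT => ns; have [s|x xX] := compactness (X := X) small_base.
    apply: contrapT => nx; apply: ns; exists s => x sx; apply: contrapT => nHx.
    by apply: nx; exists x => t ts; apply/XE; split=> //; exact: sx.
  have Htop : H `<=` defset M' j (Top L _) by move=> y _ [].
  have /XE[_] := xX (exist _ (Top L _) Htop); rewrite HE; apply => theta Stheta.
  have Htheta : H `<=` defset M' j theta by rewrite HE => y; apply.
  by have /XE[] := xX (exist _ theta Htheta).
pose theta := Conj [seq sval t | t : {classic I} <- s].
have thetaE (x : 'I_n -> M') : @sat _ MSh' _ (Iff (incl N theta) chi) (glue x (j \o idfun)).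
  rewrite sat_Iff sat_incl sat_Conj; split=> [xs|Hx _ /mapP[t ts ->]].
    by apply: sP => t ts; apply: xs; apply/mapP; exists t.
  exact: (svalP t).
exists theta; apply/seteqP.
have {}thetaE x : @sat _ MSh _ (Iff (incl N theta) chi) (glue x idfun).
  exact: (elementary_forall _ _ shelah_elementary).2.
by split=> x; have := thetaE x; rewrite sat_Iff sat_incl => -[].
Qed.

End Shelah.

Theorem theorem3p10 (L : language) (T : set (sentence L))
  (T_complete : complete_theory T) (T_NIP : NIP T)
  (M : structure L) (M_T : models M T)
  (* N is a |M|^+-saturated elementary extension of M *)
  (N : structure L) (i : M -> N) (i_elem : elementary M N i)
  (N_sat : succ_saturated M N)
  (* (N', M') is a |K|^+-saturated elementary extension of the pair (N, M),
     for some |K| >= |N| *)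
  (N' M' : structure L) (i' : M' -> N') (i'_emb : embedding i')
  (e : N -> N')
  (e_elem : elementary (pair_struct i) (pair_struct i') e)
  (j : M -> M') (j_comm : forall m : M, i' (j m) = e (i m))
  (K : Type) (N_le_K : [set: N] #<= [set: K])
  (N'_sat : succ_saturated K (pair_struct i'))
  (* G is an M-definable group in M^n *)
  (n : nat) (gamma : formula L ('I_n + M))
  (mu : formula L ('I_n + 'I_n + 'I_n + M))
  (G_group : is_group (defset M idfun gamma) (defmul M idfun mu)) :
  let MSh := shelah_struct (D := N) i idfun in
  let MSh' := shelah_struct (D := N) i' e in
  (* (a) *)
  (forall H : set ('I_n -> M),
     externally_definable i H ->
     subgroup (defset M idfun gamma) (defmul M idfun mu) H ->
     (exists2 chi : formula (shelah_lang L N) ('I_n + M),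
        H = defset MSh idfun chi &
        fsg K MSh'
          (defset MSh' j chi) (defmul M' j mu)) ->
     definable M idfun H) /\
  (* (b) *)
  (forall H : set ('I_n -> M'),
     subgroup (defset M' j gamma) (defmul M' j mu) H ->
     type_definable MSh' j H ->
     fsg K MSh' H (defmul M' j mu) ->
     exists2 Sigma : set (formula L ('I_n + M)),
       Sigma #<= [set: formula L nat] &
       H = tdefset M' j Sigma).
Proof.
move=> MSh MSh'; split=> [H _ [HG _] [chi HE H_fsg]|H [HG H_group] H_tdef H_fsg].
  rewrite HE in HG *.
  exact: (fsg_definable i_elem N_sat i'_emb e_elem j_comm N_le_K N'_sat T_NIP M_T
    G_group HG H_fsg).
exact: (fsg_type_definable i_elem N_sat i'_emb e_elem j_comm N_le_K N'_sat T_NIP M_T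
  G_group HG H_group H_tdef H_fsg).
Qed.
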